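(* Let $N\ge 1$ be an integer, $T>0$, $q>1$, $\delta>1$, $\eta_-,\eta_+\ge 0$, $M>0$, and let $p$ be the conjugate exponent of $q$ ($\frac1p+\frac1q=1$). Then there is a constant $\theta>p$, depending only on $q,\delta,N,\eta_-,\eta_+,M$, and, for every $\tau\in(0,T]$, a constant $C(\tau)>0$, depending only on $q,\delta,N,\eta_-,\eta_+,M$ and $\tau$, such that the following holds. Let $H:\mathbb{R}^N\times(0,T)\times\mathbb{R}^N\to\mathbb{R}$ be any continuous function satisfying $$\frac1\delta|z|^q-\eta_-\le H(x,t,z)\le \delta|z|^q+\eta_+\qquad\forall (x,t,z)\in\mathbb{R}^N\times(0,T)\times\mathbb{R}^N,$$ and let $u\in C(\mathbb{R}^N\times[0,T])$ be any viscosity solution of $$u_t+H(x,t,Du)=0\quad\text{in }\mathbb{R}^N\times(0,T)$$ with $|u(x,t)|\le M$ for all $(x,t)\in\mathbb{R}^N\times(0,T)$. Then, for every $\tau\in(0,T]$, $$|u(x,t)-u(y,s)|\le C(\tau)\left[|x-y|^{\frac{\theta-p}{\theta-1}}+|t-s|^{\frac{\theta-p}{\theta}}\right]\qquad\forall (x,t),(y,s)\in\mathbb{R}^N\times[\tau,T].$$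
   Context: $C(\mathbb{R}^N\times[0,T])$ is the space of continuous real functions on $\mathbb{R}^N\times[0,T]$; $u_t=\partial u/\partial t$ and $Du$ is the gradient in $x$. $H$ is not assumed convex in $z$, and no initial condition is prescribed. *)

(* Defs.v *)
From mathcomp Require Import all_boot all_order all_algebra.
From mathcomp Require Import all_classical all_reals all_analysis.
Set Implicit Arguments.
Unset Strict Implicit.
Unset Printing Implicit Defensive.
Import Order.TTheory GRing.Theory Num.Theory.
Import numFieldNormedType.Exports.
Local Open Scope classical_set_scope.
Local Open Scope ring_scope.

(* The library norm on row vectors is the sup norm; it induces the same
   topology, but the growth conditions and estimates use the Euclidean one. *)
Definition enorm (R : realType) (N : nat) (z : 'rV[R]_N) : R :=
  Num.sqrt (\sum_(i < N) z ord0 i ^+ 2).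

Definition strip (R : realType) (N : nat) (T : R) : set ('rV[R]_N * R) :=
  [set xt | 0 < xt.2 < T].

Definition gradx (R : realType) (N : nat) (phi : 'rV[R]_N * R -> R)
    (xt : 'rV[R]_N * R) : 'rV[R]_N :=
  \row_(i < N) 'D_(delta_mx ord0 i) (fun y : 'rV[R]_N => phi (y, xt.2)) xt.1.

Definition dert (R : realType) (N : nat) (phi : 'rV[R]_N * R -> R)
    (xt : 'rV[R]_N * R) : R :=
  derive1 (fun s : R => phi (xt.1, s)) xt.2.

(* phi is a total function, but its values outside A play no role when A is
   open. *)
Definition C1_on (R : realType) (N : nat) (A : set ('rV[R]_N * R))
    (phi : 'rV[R]_N * R -> R) : Prop :=
  [/\ forall xt, A xt -> differentiable phi xt,
      {within A, continuous (gradx phi)} &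
      {within A, continuous (dert phi)}].

(* Local extrema are taken over neighborhoods in the whole space; since the
   strip is open this is the same as neighborhoods within the strip. *)
Definition local_max_at (R : realType) (N : nat) (w : 'rV[R]_N * R -> R)
    (xt : 'rV[R]_N * R) : Prop :=
  \forall ys \near xt, w ys <= w xt.

Definition local_min_at (R : realType) (N : nat) (w : 'rV[R]_N * R -> R)
    (xt : 'rV[R]_N * R) : Prop :=
  \forall ys \near xt, w xt <= w ys.

Definition viscosity_subsolution (R : realType) (N : nat) (T : R)
    (H : 'rV[R]_N -> R -> 'rV[R]_N -> R) (u : 'rV[R]_N * R -> R) : Prop :=
  forall phi xt, C1_on (@strip R N T) phi -> strip T xt ->
    local_max_at (u \- phi) xt ->
    dert phi xt + H xt.1 xt.2 (gradx phi xt) <= 0.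

Definition viscosity_supersolution (R : realType) (N : nat) (T : R)
    (H : 'rV[R]_N -> R -> 'rV[R]_N -> R) (u : 'rV[R]_N * R -> R) : Prop :=
  forall phi xt, C1_on (@strip R N T) phi -> strip T xt ->
    local_min_at (u \- phi) xt ->
    0 <= dert phi xt + H xt.1 xt.2 (gradx phi xt).

(* For the equation u_t + H(x, t, Du) = 0 in R^N x (0, T). *)
Definition viscosity_solution (R : realType) (N : nat) (T : R)
    (H : 'rV[R]_N -> R -> 'rV[R]_N -> R) (u : 'rV[R]_N * R -> R) : Prop :=
  [/\ {within @strip R N T, continuous u},
      viscosity_subsolution T H u & viscosity_supersolution T H u].

Definition hamiltonian_continuous (R : realType) (N : nat) (T : R)
    (H : 'rV[R]_N -> R -> 'rV[R]_N -> R) : Prop :=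
  {within [set a : 'rV[R]_N * R * 'rV[R]_N | 0 < a.1.2 < T],
    continuous (fun a : 'rV[R]_N * R * 'rV[R]_N => H a.1.1 a.1.2 a.2)}.

(* Main.v *)
From HB Require Import structures.
Require Import Defs.
From mathcomp Require Import all_boot all_order all_algebra.
From mathcomp Require Import all_classical all_reals all_analysis.
From mathcomp Require Import ring lra.
Set Implicit Arguments.
Unset Strict Implicit.
Unset Printing Implicit Defensive.
Import Order.TTheory GRing.Theory Num.Theory.
Import numFieldNormedType.Exports.
Local Open Scope classical_set_scope.
Local Open Scope ring_scope.

(** The Hamiltonian enters only through its growth, which yields two
    comparisons of [u] with the action [|x - y|^p (t - s)^(1 - p)] of straight
    segments. As a subsolution of [u_t + |Du|^q / delta <= eta_m], [u] grows
    between [(y, s)] and [(x, t)] by at most [A] times the action plus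
    [O(t - s)], for every [y] ([subsolution_action_upper]). As a supersolution
    of [u_t + delta |Du|^q >= - eta_p], [u] grows by at least [c] times the
    action minus [O(t - s)] for some [y] ([supersolution_action_lower]). Both
    follow from explicit smooth test functions: a paraboloid moving along the
    segment, for which Young's inequality makes the equation linear, and an
    inverted power [- |y - x|^p], rounded at its vertex and weighted by an
    exponential in time, which is a strict subsolution on a time interval of
    length comparable to [t - s].

    Iterating the lower bound backwards from [(x, t)] over the times [h],
    [La h], [La^2 h], ... gives a chain of points; let [E(h)] be its total
    action down to the time [t - h]. By the upper bound, [E(h)] is at most a
    constant times the action of the straight segment from [x] to the current
    point of the chain, plus [O(h)]. A displacement made within the time [h] is
    cheaper by the factor [La^(1 - p)] once it is spread over the time [La h];
    hence, if nearly all of [E(La h)] were spent within the time [h], the segment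
    would be too cheap.
    So a fixed fraction of the action is spent at each scale, and
    [E(h) <= mu E(La h) + O(h)] with [mu < 1] ([chain_decay]). Iterating up to a
    time of order one, where [E] is bounded because [u] is, gives
    [E(h) <= X h^ga] for some [ga] in (0, 1) ([chain_action_small]). This is a
    discrete form of the gain of integrability from a reverse Hoelder
    inequality, and [theta] is the exponent with [1 - p / theta = ga].

    Thus going back from [(x, t)] by the time [h] one reaches a point [y] with
    [|x - y|] of order [h^(1 - 1 / theta)] where [u] is not larger than
    [u(x, t) + O(h)]. The upper bound from [(y, t - h)] to [(x', t)], with [h]
    chosen so that [|x - x'| = h^(1 - 1 / theta)], gives the estimate in space
    ([holder_space]); the estimate at time [s] between [x] and the point [y]
    with [h = t - s] then gives the one in time ([holder_time]). *)

(** * The Euclidean norm, and the action of straight segments *)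

Lemma enorm_ge0 (R : realType) N (z : 'rV[R]_N) : 0 <= enorm z.
Proof. exact: sqrtr_ge0. Qed.

Lemma sqr_enorm (R : realType) N (z : 'rV[R]_N) :
  enorm z ^+ 2 = \sum_i z ord0 i ^+ 2.
Proof. by rewrite sqr_sqrtr// sumr_ge0// => i _; rewrite sqr_ge0. Qed.

Lemma enorm0 (R : realType) N : enorm (0 : 'rV[R]_N) = 0.
Proof. by rewrite /enorm big1 ?sqrtr0// => i _; rewrite mxE expr0n. Qed.

Lemma enormZ (R : realType) N (a : R) (z : 'rV[R]_N) :
  enorm (a *: z) = `|a| * enorm z.
Proof.
rewrite /enorm -sqrtr_sqr -sqrtrM ?sqr_ge0// mulr_sumr.
by congr Num.sqrt; apply: eq_bigr => i _; rewrite mxE exprMn.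
Qed.

Lemma enormN (R : realType) N (z : 'rV[R]_N) : enorm (- z) = enorm z.
Proof. by rewrite -scaleN1r enormZ normrN1 mul1r. Qed.

Lemma enormC (R : realType) N (x y : 'rV[R]_N) : enorm (x - y) = enorm (y - x).
Proof. by rewrite -enormN opprB. Qed.

Lemma norm_le_enorm (R : realType) N (z : 'rV[R]_N) : `|z| <= enorm z.
Proof.
rewrite /Num.norm/= mx_normrE; apply/bigmax_leP; split=> [|[i j] _ /=].
  exact: enorm_ge0.
rewrite -sqrtr_sqr ler_wsqrtr// (ord1 i) (bigD1 j)//= lerDl.
by apply: sumr_ge0 => k _; rewrite sqr_ge0.
Qed.

(** Cauchy-Schwarz, from the nonnegative sum of the squares of
    [enorm z * v_i - enorm v * z_i]. *)
Lemma dot_le_enorm (R : realType) N (z v : 'rV[R]_N) :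
  \sum_i z ord0 i * v ord0 i <= enorm z * enorm v.
Proof.
have [a0 b0] := (enorm_ge0 z, enorm_ge0 v).
have [ab0|ab_neq0] := eqVneq (enorm z * enorm v) 0.
  rewrite ab0 big1// => i _.
  have zero (w : 'rV[R]_N) : enorm w = 0 -> w ord0 i = 0.
    move=> w0; have := sqr_enorm w; rewrite w0 expr0n/= => /esym/eqP.
    rewrite psumr_eq0; last by move=> j _; rewrite sqr_ge0.
    by move=> /allP/(_ i); rewrite mem_index_enum sqrf_eq0/= => /(_ isT)/eqP.
  by move: ab0 => /eqP; rewrite mulf_eq0 => /orP[] /eqP /zero ->;
    rewrite ?mul0r ?mulr0.
have ab_gt0 : 0 < enorm z * enorm v by rewrite lt_neqAle eq_sym ab_neq0 mulr_ge0.
rewrite -(ler_pM2l ab_gt0) -(ler_pM2l (@ltr0Sn R 1)).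
have : 0 <= \sum_i (enorm z * v ord0 i - enorm v * z ord0 i) ^+ 2.
  by apply: sumr_ge0 => i _; rewrite sqr_ge0.
have -> : \sum_i (enorm z * v ord0 i - enorm v * z ord0 i) ^+ 2 =
  enorm z ^+ 2 * \sum_i v ord0 i ^+ 2 + enorm v ^+ 2 * \sum_i z ord0 i ^+ 2
  - 2 * (enorm z * enorm v * \sum_i z ord0 i * v ord0 i).
  rewrite !mulr_sumr -big_split/= -sumrB; apply: eq_bigr => i _; ring.
rewrite -!sqr_enorm; lra.
Qed.

Lemma enormD (R : realType) N (x y : 'rV[R]_N) :
  enorm (x + y) <= enorm x + enorm y.
Proof.
rewrite -(@ler_pXn2r _ 2) ?nnegrE ?addr_ge0 ?enorm_ge0// sqr_enorm.
have -> : \sum_i (x + y) ord0 i ^+ 2 =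
    \sum_i x ord0 i ^+ 2 + \sum_i y ord0 i ^+ 2
    + 2 * \sum_i x ord0 i * y ord0 i.
  rewrite mulr_sumr -!big_split/=; apply: eq_bigr => i _; rewrite mxE; ring.
rewrite -!sqr_enorm; have := dot_le_enorm x y; lra.
Qed.

Lemma enorm_triangle (R : realType) N (y x z : 'rV[R]_N) :
  enorm (x - z) <= enorm (x - y) + enorm (y - z).
Proof. by rewrite -[x - z](subrKA y); exact: enormD. Qed.

(** Up to a constant factor, the integral of the [p]-th power of the velocity
    for a segment of length [r] run at constant speed during the time [h]. *)
Definition action (R : realType) (p h r : R) : R := r `^ p * h `^ (1 - p).

Lemma action_ge0 (R : realType) (p h r : R) : 0 <= action p h r.
Proof. by rewrite mulr_ge0 ?powR_ge0. Qed.

Lemma ler_action (R : realType) (p h r s : R) :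
  0 <= p -> 0 <= r -> r <= s -> action p h r <= action p h s.
Proof.
move=> p0 r0 rs; rewrite ler_wpM2r ?powR_ge0// ge0_ler_powR// ?nnegrE//.
exact: le_trans rs.
Qed.

Lemma action_scale (R : realType) (p h k : R) : 0 < h -> 0 <= k ->
  action p h (h * k) = h * k `^ p.
Proof.
move=> h0 k0; rewrite /action powRM// ?(ltW h0)// mulrAC -powRD.
  by rewrite subrKC powRr1// ltW.
by rewrite (gt_eqF h0) implybT.
Qed.

(** Jensen's inequality for [r |-> r ^ p], with weights proportional to the
    times: a broken line costs at least as much as the straight segment. *)
Lemma actionD (R : realType) (p h k r s : R) :
  1 <= p -> 0 < h -> 0 < k -> 0 <= r -> 0 <= s ->
  action p (h + k) (r + s) <= action p h r + action p k s.
Proof.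
move=> p1 h0 k0 r0 s0.
have hk0 : 0 < h + k by lra.
have t01 : 0 <= h / (h + k) <= 1.
  by rewrite divr_ge0 ?(ltW h0) ?(ltW hk0)//= ler_pdivrMr// mul1r; lra.
have rh : 0 <= r / h by rewrite divr_ge0// ltW.
have sk : 0 <= s / k by rewrite divr_ge0// ltW.
have hD : h / (h + k) * (r / h) + k / (h + k) * (s / k) = (r + s) / (h + k).
  by field; lra.
have kE : 1 - h / (h + k) = k / (h + k) by field; lra.
pose t := Itv01 (andP t01).1 (andP t01).2.
have := @convex_powR R p p1 t (r / h) (s / k).
rewrite !inE/= !in_itv/= !andbT => /(_ rh sk).
rewrite [X in X `^ p <= _](_ : _ = (r + s) / (h + k)); last by rewrite -hD -kE.
rewrite [X in _ <= X](_ : _ = h / (h + k) * (r / h) `^ p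
  + k / (h + k) * (s / k) `^ p) => [J|]; last by rewrite -kE.
have -> : r + s = (h + k) * ((r + s) / (h + k)) by field; lra.
rewrite action_scale//; last by rewrite divr_ge0 ?(ltW hk0)// addr_ge0.
rewrite -{2}[r](@mulfVK _ h) ?gt_eqF// [_ / h * h]mulrC action_scale//.
rewrite -{2}[s](@mulfVK _ k) ?gt_eqF// [_ / k * k]mulrC action_scale//.
have -> : h * (r / h) `^ p + k * (s / k) `^ p =
    (h + k) * (h / (h + k) * (r / h) `^ p + k / (h + k) * (s / k) `^ p).
  by field; lra.
by rewrite ler_pM2l.
Qed.

Lemma powR_addr_le (R : realType) (p r s : R) :
  1 <= p -> 0 <= r -> 0 <= s ->
  (r + s) `^ p <= 2 `^ (p - 1) * (r `^ p + s `^ p).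
Proof.
move=> p1 r0 s0; have := actionD p1 ltr01 ltr01 r0 s0.
rewrite /action !powR1 !mulr1 -(opprB p 1) powRN.
by rewrite ler_pdivrMr ?powR_gt0// mulrC.
Qed.

Lemma conjugate_mul (R : realType) (p q : R) :
  0 < p -> 0 < q -> p^-1 + q^-1 = 1 -> p * q = p + q.
Proof.
move=> p0 q0 /(congr1 (fun z => z * (p * q))); rewrite mul1r => <-.
by field; rewrite !gt_eqF.
Qed.

(** Young's inequality with the weight that puts exactly [d^-1] in front of
    [a ^ q], the coercivity constant of the Hamiltonian. *)
Lemma young (R : realType) (p q d a b : R) : 0 < d -> 0 < p -> 0 < q ->
  p^-1 + q^-1 = 1 -> 0 <= a -> 0 <= b ->
  a * b <= d^-1 * a `^ q + d `^ (p - 1) * b `^ p.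
Proof.
move=> d0 p0 q0 pq a0 b0.
have [pV qV] : p^-1 <= 1 /\ q^-1 <= 1.
  by have := invr_gt0 p; have := invr_gt0 q; rewrite p0 q0; split; lra.
have [dl dr] : d^-1 `^ q^-1 `^ q = d^-1 /\ d `^ q^-1 `^ p = d `^ (p - 1).
  rewrite -!powRrM mulVf ?gt_eqF// powRr1 ?invr_ge0 ?ltW//; split=> //.
  by congr (_ `^ _); rewrite (_ : q^-1 = 1 - p^-1) ?mulrBl ?mul1r ?mulVf ?gt_eqF//; lra.
have -> : a * b = (d `^ q^-1 * b) * (d^-1 `^ q^-1 * a).
  rewrite mulrACA -powRM ?invr_ge0 ?(ltW d0)// mulfV ?gt_eqF// powR1 mul1r.
  exact: mulrC.
have := @conjugate_powR R (d `^ q^-1 * b) (d^-1 `^ q^-1 * a) p q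
  (mulr_ge0 (powR_ge0 _ _) b0) (mulr_ge0 (powR_ge0 _ _) a0) p0 q0 pq.
rewrite !powRM ?powR_ge0// dl dr => /le_trans; apply.
rewrite addrC; apply: lerD.
  by apply: ler_piMr => //; rewrite mulr_ge0 ?powR_ge0 ?invr_ge0 ?(ltW d0).
by apply: ler_piMr => //; rewrite mulr_ge0 ?powR_ge0.
Qed.

(** The two properties of [u] on which the regularity argument rests. The upper
    bound holds for all end points, the lower bound for a suitable one: it
    replaces the minimizing curve of a control problem, of which only
    finitely many points are ever needed. *)
Definition action_upper (R : realType) N (p A eta T : R) (u : 'rV[R]_N * R -> R) :=
  forall x y s t, 0 < s -> s < t -> t < T ->
  u (x, t) <= u (y, s) + A * action p (t - s) (enorm (x - y)) + eta * (t - s).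

Definition action_lower (R : realType) N (p c eta T : R) (u : 'rV[R]_N * R -> R) :=
  forall x s t, 0 < s -> s < t -> t < T ->
  exists y, u (y, s) + c * action p (t - s) (enorm (x - y)) - eta * (t - s)
            <= u (x, t).

(** * Smooth test functions *)

(** Reduces directional derivatives to functions of one real variable, for
    which the chain rule [is_derive1_comp] is stated. *)
Lemma is_derive_line (R : realType) (V : normedModType R) (f : V -> R)
    (a v : V) (df : R) :
  is_derive (0 : R) 1 (fun h => f (a + h *: v)) df -> is_derive a v f df.
Proof.
have E : (fun h : R => h^-1 *: ((f \o shift a) (h *: v) - f a)) =
    (fun h : R => h^-1 *: (((fun h => f (a + h *: v)) \o shift 0) (h *: (1 : R))
                           - f (a + 0 *: v))).
  apply/funext => h /=.
  by rewrite addr0 scale0r addr0 [a + _]addrC /GRing.scale/= mulr1.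
case=> [exd vd]; split.
  by rewrite /derivable E.
by rewrite -vd /derive E.
Qed.

Lemma is_derive_slice1 (R : realType) (V W : normedModType R) (f : V * W -> R)
    (xt : V * W) (v : V) (df : R) :
  is_derive xt (v, 0) f df -> is_derive xt.1 v (fun y => f (y, xt.2)) df.
Proof.
have E : (fun h : R => h^-1 *: (((fun y => f (y, xt.2)) \o shift xt.1) (h *: v)
           - f (xt.1, xt.2))) =
    (fun h : R => h^-1 *: ((f \o shift xt) (h *: (v, 0)) - f xt)).
  apply/funext => h; congr (_ *: (_ - _)); last by case: xt.
  case: xt => x t /=.
  change (f (h *: v + x, t) = f (h *: v + x, h *: (0 : W) + t)).
  by rewrite scaler0 add0r.
by case=> exd vd; split; rewrite ?/derivable -?vd /derive E.
Qed.

Lemma is_derive_slice2 (R : realType) (V W : normedModType R) (f : V * W -> R)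
    (xt : V * W) (w : W) (df : R) :
  is_derive xt (0, w) f df -> is_derive xt.2 w (fun y => f (xt.1, y)) df.
Proof.
have E : (fun h : R => h^-1 *: (((fun y => f (xt.1, y)) \o shift xt.2) (h *: w)
           - f (xt.1, xt.2))) =
    (fun h : R => h^-1 *: ((f \o shift xt) (h *: (0, w)) - f xt)).
  apply/funext => h; congr (_ *: (_ - _)); last by case: xt.
  case: xt => x t /=.
  change (f (x, h *: w + t) = f (h *: (0 : V) + x, h *: w + t)).
  by rewrite scaler0 add0r.
by case=> exd vd; split; rewrite ?/derivable -?vd /derive E.
Qed.

Lemma differentiable_fst (R : realType) (V W : normedModType R) (xt : V * W) :
  differentiable (fst : V * W -> V) xt.
Proof.
have fst_lin : linear (fst : V * W -> V) by [].
pose fstM := GRing.isLinear.Build _ _ _ _ _ fst_lin.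
pose fstL : {linear (V * W)%type -> V} := HB.pack (fst : V * W -> V) fstM.
rewrite (_ : fst = fstL)//; apply: linear_differentiable => z.
exact: cvg_fst.
Qed.

Lemma differentiable_snd (R : realType) (V W : normedModType R) (xt : V * W) :
  differentiable (snd : V * W -> W) xt.
Proof.
have snd_lin : linear (snd : V * W -> W) by [].
pose sndM := GRing.isLinear.Build _ _ _ _ _ snd_lin.
pose sndL : {linear (V * W)%type -> W} := HB.pack (snd : V * W -> W) sndM.
rewrite (_ : snd = sndL)//; apply: linear_differentiable => z.
exact: cvg_snd.
Qed.

Section TestFunction.
Context (R : realType) (N : nat).
Variables (y v : 'rV[R]_N) (s nu k0 al k r m ka n a : R).

Definition moving_dist2 (xt : 'rV[R]_N * R) : R :=
  \sum_(i < N) (xt.1 ord0 i - y ord0 i - (xt.2 - s) * v ord0 i) ^+ 2 + nu.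

(** One family covers both comparison arguments: [k = 0], [r = 1] and [v] the
    velocity of a segment give a moving paraboloid; [v = 0], [r = p / 2] and
    [al < 0] give an inverted power [- |x - y|^p] with an exponential weight in
    time. The positive number [nu] keeps the base of the power positive, so
    that it is smooth also at its vertex; the last term is the penalization of
    [penalized_min]. *)
Definition test_fun (xt : 'rV[R]_N * R) : R :=
  k0 + al * expR (k * (xt.2 - s)) * moving_dist2 xt `^ r + m * (xt.2 - s)
  + ka * expR (n * (xt.2 - a)).

Hypothesis nu_gt0 : 0 < nu.

Lemma moving_dist2_gt0 xt : 0 < moving_dist2 xt.
Proof. by rewrite ltr_wpDl// sumr_ge0// => i _; rewrite sqr_ge0. Qed.

Lemma is_derive_affine (c d h : R) : is_derive h 1 (fun h : R => c + h * d) d.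
Proof.
have : is_derive h 1 (cst c + d \*: (id : R -> R)) (0 + d *: 1).
  exact: is_deriveD.
congr is_derive; first by apply/funext => z /=; rewrite /GRing.scale/= mulrC.
by rewrite add0r /GRing.scale/= mulr1.
Qed.

Lemma is_derive_test (xt w : 'rV[R]_N * R) :
  is_derive xt w test_fun
    (al * expR (k * (xt.2 - s)) *
       (k * w.2 * moving_dist2 xt `^ r
        + r * moving_dist2 xt `^ (r - 1) *
          (2 * \sum_i (xt.1 ord0 i - y ord0 i - (xt.2 - s) * v ord0 i) *
                  (w.1 ord0 i - w.2 * v ord0 i)))
     + m * w.2 + ka * expR (n * (xt.2 - a)) * (n * w.2)).
Proof.
apply: is_derive_line.
pose b i := xt.1 ord0 i - y ord0 i - (xt.2 - s) * v ord0 i.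
pose d i := w.1 ord0 i - w.2 * v ord0 i.
pose Q h := \sum_(i < N) (b i + h * d i) ^+ 2 + nu.
have QE h : moving_dist2 (xt + h *: w) = Q h.
  rewrite /moving_dist2 /Q; congr (_ + _); apply: eq_bigr => i _.
  by rewrite /= !mxE /b /d /GRing.scale/=; congr (_ ^+ 2); ring.
have Q0 : Q 0 = moving_dist2 xt by rewrite -QE scale0r addr0.
have Qgt0 : 0 < Q 0 by rewrite Q0 moving_dist2_gt0.
have dQ : is_derive (0 : R) 1 Q (2 * \sum_i b i * d i).
  have : is_derive (0 : R) 1
    (\sum_(i < N) (fun h : R => b i + h * d i) ^+ 2 + cst nu)
    (\sum_(i < N) (2%:R * (b i + 0 * d i) ^+ 1) *: d i + 0).
    apply: is_deriveD; apply: is_derive_sum => i.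
    by apply: is_deriveX; exact: is_derive_affine.
  congr is_derive.
    by apply/funext => h; rewrite /Q/= fctE fct_sumE.
  rewrite addr0 mulr_sumr; apply: eq_bigr => i _.
  by rewrite /GRing.scale/= mul0r addr0 expr1 mulrA.
have dE (c e : R) : is_derive (0 : R) 1
    (fun h : R => expR (c * (xt.2 + h * w.2 - e)))
    (expR (c * (xt.2 - e)) * (c * w.2)).
  have dA := is_derive_affine (c * (xt.2 - e)) (c * w.2) 0.
  have := @is_derive1_comp _ expR _ _ _ _ (is_derive_expR _) dA.
  rewrite mul0r addr0; congr is_derive.
  by apply/funext => h /=; congr expR; ring.
have dP := is_derive1_comp (is_derive1_powR r Qgt0) dQ.
have dM := is_derive_affine (m * (xt.2 - s)) (m * w.2) 0.
have dEP := is_deriveZ al (is_deriveM (dE k s) dP).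
have dF := is_deriveD (is_deriveD (is_deriveD (is_derive_cst k0 _ _) dEP) dM)
   (is_deriveZ ka (dE n a)).
move: dF; congr is_derive.
  apply/funext => h; rewrite /test_fun QE/=.
  transitivity (k0 + al * (expR (k * (xt.2 + h * w.2 - s)) * Q h `^ r)
    + (m * (xt.2 - s) + h * (m * w.2))
    + ka * expR (n * (xt.2 + h * w.2 - a))) => //.
  by rewrite /GRing.scale/=; ring.
by rewrite /= Q0 mul0r addr0 /GRing.scale/=; ring.
Qed.

Lemma dert_test_fun xt : dert test_fun xt =
  al * expR (k * (xt.2 - s)) *
    (k * moving_dist2 xt `^ r
     - r * moving_dist2 xt `^ (r - 1) *
       (2 * \sum_i (xt.1 ord0 i - y ord0 i - (xt.2 - s) * v ord0 i) * v ord0 i))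
  + m + ka * n * expR (n * (xt.2 - a)).
Proof.
have := is_derive_test xt (0, 1) => /is_derive_slice2 H.
rewrite /dert derive1E (derive_val (is_derive := H))/= !mulr1.
have -> : \sum_i (xt.1 ord0 i - y ord0 i - (xt.2 - s) * v ord0 i) *
      ((0 : 'rV[R]_N) ord0 i - 1 * v ord0 i) =
    - \sum_i (xt.1 ord0 i - y ord0 i - (xt.2 - s) * v ord0 i) * v ord0 i.
  by rewrite -sumrN; apply: eq_bigr => i _; rewrite mxE mul1r sub0r mulrN.
by ring.
Qed.

Lemma gradx_test_fun xt : gradx test_fun xt =
  (2 * al * expR (k * (xt.2 - s)) * r * moving_dist2 xt `^ (r - 1)) *:
    (xt.1 - y - (xt.2 - s) *: v).
Proof.
apply/rowP => i; rewrite !mxE.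
have := is_derive_test xt (delta_mx ord0 i, 0) => /is_derive_slice1 H.
rewrite (derive_val (is_derive := H))/= !(mulr0, mul0r, addr0, add0r).
rewrite (bigD1 i)//= big1 => [|j ji]; last first.
  by rewrite mxE eqxx (negPf ji)/= mul0r subr0 mulr0.
by rewrite mxE !eqxx/= mul0r subr0 mulr1 addr0; ring.
Qed.

Lemma differentiable_moving_coord i xt :
  differentiable (fun xt : 'rV[R]_N * R =>
    xt.1 ord0 i - y ord0 i - (xt.2 - s) * v ord0 i) xt.
Proof.
apply: differentiableB.
  apply: differentiableB => //.
  apply: (@differentiable_comp _ _ _ _ fst (fun z : 'rV[R]_N => z ord0 i)) => //.
    exact: differentiable_fst.
  exact: differentiable_coord.
apply: differentiableM => //.
by apply: differentiableB => //; exact: differentiable_snd.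
Qed.

Lemma differentiable_moving_dist2 xt : differentiable moving_dist2 xt.
Proof.
have -> : moving_dist2 = \sum_(i < N) (fun xt : 'rV[R]_N * R =>
    xt.1 ord0 i - y ord0 i - (xt.2 - s) * v ord0 i) ^+ 2 + cst nu.
  by apply/funext => z; rewrite /moving_dist2 fctE fct_sumE.
apply: differentiableD => //; apply: differentiable_sum => i.
by apply: differentiableX; exact: differentiable_moving_coord.
Qed.

Lemma differentiable_expR_time (c e : R) (xt : 'rV[R]_N * R) :
  differentiable (fun xt : 'rV[R]_N * R => expR (c * (xt.2 - e))) xt.
Proof.
apply: (@differentiable_comp _ _ _ _ (fun xt : 'rV[R]_N * R => c * (xt.2 - e))
  expR); last exact/derivable1_diffP.
apply: differentiableM => //; apply: differentiableB => //.
exact: differentiable_snd.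
Qed.

Lemma differentiable_powR_dist2 (b : R) xt :
  differentiable (fun xt => moving_dist2 xt `^ b) xt.
Proof.
apply: (@differentiable_comp _ _ _ _ moving_dist2 (fun z => z `^ b)).
  exact: differentiable_moving_dist2.
apply/derivable1_diffP.
exact: (ex_derive (is_derive := is_derive1_powR b (moving_dist2_gt0 xt))).
Qed.

Lemma differentiable_test_fun xt : differentiable test_fun xt.
Proof.
apply: differentiableD; [apply: differentiableD; [apply: differentiableD => //|]|].
- apply: differentiableM; last exact: differentiable_powR_dist2.
  by apply: differentiableM => //; exact: differentiable_expR_time.
- apply: differentiableM => //; apply: differentiableB => //.
  exact: differentiable_snd.
- by apply: differentiableM => //; exact: differentiable_expR_time.
Qed.

Lemma C1_on_test_fun T : C1_on (@strip R N T) test_fun.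
Proof.
split=> [xt _||]; first exact: differentiable_test_fun.
- apply: continuous_subspaceT.
  rewrite (_ : gradx _ = fun xt => (2 * al * expR (k * (xt.2 - s)) * r *
      moving_dist2 xt `^ (r - 1)) *: (xt.1 - y - (xt.2 - s) *: v)); last first.
    by apply/funext => xt; exact: gradx_test_fun.
  move=> xt; apply: cvgZ; last first.
    apply: cvgB; first by apply: cvgB; [exact: cvg_fst|exact: cvg_cst].
    by apply: cvgZr_tmp; apply: cvgB; [exact: cvg_snd|exact: cvg_cst].
  have dc : differentiable (fun xt => 2 * al * expR (k * (xt.2 - s)) * r *
      moving_dist2 xt `^ (r - 1)) xt.
    apply: differentiableM; last exact: differentiable_powR_dist2.
    apply: differentiableM; last exact: differentiable_cst.
    apply: differentiableM; first exact: differentiable_cst.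
    exact: differentiable_expR_time.
  exact: (differentiable_continuous dc).
- apply: continuous_subspaceT => xt; apply: differentiable_continuous.
  rewrite (_ : dert _ = fun xt => al * expR (k * (xt.2 - s)) *
    (k * moving_dist2 xt `^ r - r * moving_dist2 xt `^ (r - 1) *
      (2 * (\sum_i (fun xt : 'rV[R]_N * R => (xt.1 ord0 i - y ord0 i
                             - (xt.2 - s) * v ord0 i) * v ord0 i)) xt))
    + m + ka * n * expR (n * (xt.2 - a))); last first.
    by apply/funext => z; rewrite dert_test_fun fct_sumE.
  apply: differentiableD; last first.
    by apply: differentiableM => //; exact: differentiable_expR_time.
  apply: differentiableD => //; apply: differentiableM.
    by apply: differentiableM => //; exact: differentiable_expR_time.
  apply: differentiableB.
    by apply: differentiableM => //; exact: differentiable_powR_dist2.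
  apply: differentiableM.
    by apply: differentiableM => //; exact: differentiable_powR_dist2.
  apply: differentiableM => //; apply: differentiable_sum => i.
  by apply: differentiableM => //; exact: differentiable_moving_coord.
Qed.
End TestFunction.

(** * Interior minima by penalization in time *)

(** The minimum of [w] over [s <= t <= t1] may sit on the final time [t1], where
    a two-sided test is impossible. Adding [expR (n * (t - a))] with [a] between
    [t0] and [t1] and [n] large hardly changes the negative value at [t0] and
    makes the values at [t1] positive. The added term increases in time,
    which is the harmless direction in both comparison arguments. *)
Lemma penalized_min (R : realType) (N : nat) (T s t0 t1 Rad L : R)
    (w : 'rV[R]_N * R -> R) (x0 : 'rV[R]_N) :
  (forall xt, strip T xt -> {for xt, continuous w}) ->
  0 < s -> s <= t0 -> t0 < t1 -> t1 < T -> 0 <= L ->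
  (forall y, 0 <= w (y, s)) ->
  (forall y t, s <= t <= t1 -> w (y, t) < 0 -> `|y| < Rad) ->
  (forall y t, s <= t <= t1 -> - L <= w (y, t)) ->
  w (x0, t0) < 0 ->
  exists n a y t, [/\ 0 < n, s < t < t1 &
    local_min_at (fun xt => w xt + expR (n * (xt.2 - a))) (y, t)].
Proof.
move=> wC s0 st0 t01 t1T L0 ws wR wL w0.
pose b := (t1 - t0) / 2; have b0 : 0 < b by rewrite /b; lra.
pose ka := - w (x0, t0); have ka0 : 0 < ka by rewrite /ka; lra.
have kaV0 : 0 < ka^-1 by rewrite invr_gt0.
pose n := (ka^-1 + L) / b; have n0 : 0 < n by rewrite divr_gt0// ltr_wpDr.
have nb : n * b = ka^-1 + L by rewrite /n mulfVK ?gt_eqF.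
have enb : 1 + (ka^-1 + L) <= expR (n * b) by rewrite nb expR_ge1Dx.
pose a := t0 + b.
pose W (xt : 'rV[R]_N * R) := w xt + expR (n * (xt.2 - a)).
have W0 : W (x0, t0) < 0.
  rewrite /W/= /a opprD addrA subrr add0r mulrN expRN.
  have : (expR (n * b))^-1 < ka.
    by rewrite invf_plt ?posrE ?expR_gt0//; lra.
  by rewrite /ka; lra.
have Wt1 y : 0 < W (y, t1).
  have := wL y t1; rewrite lexx andbT => /(_ (ltW (le_lt_trans st0 t01))).
  rewrite /W/= (_ : t1 - a = b); last by rewrite /a /b; lra.
  lra.
have Ws y : 0 < W (y, s).
  by rewrite /W/= ltr_wpDl// expR_gt0.
have WC xt : strip T xt -> {for xt, continuous W}.
  move=> Txt; apply: cvgD; first exact: wC.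
  exact: (differentiable_continuous (differentiable_expR_time n a xt)).
pose K := [set y : 'rV[R]_N | `|y| <= Rad] `*` `[s, t1]%classic.
have Kc : compact K.
  apply: compact_setX; last exact: segment_compact.
  apply: bounded_closed_compact.
    exists Rad; split; first exact: num_real.
    by move=> z Rz y /= /le_trans; apply; exact: ltW.
  rewrite (_ : mkset _ = (fun z : 'rV[R]_N => `|z|) @^-1` [set r : R | r <= Rad])//.
  by apply: closed_comp => [y _|]; [exact: norm_continuous|exact: closed_le].
have KT xt : K xt -> strip T xt.
  by case=> _ /=; rewrite in_itv/= /strip/= => /andP[? ?]; apply/andP; split; lra.
have K0 : K (x0, t0).
  split; last by rewrite /= in_itv/= st0 ltW.
  by apply/ltW/(wR x0 t0) => //; rewrite st0 ltW.
have [||[y t] /[1!inE] Kyt ytmin] := @compact_EVT_min _ _ W K _ Kc.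
- by exists (x0, t0).
- apply: continuous_in_subspaceT => xt /[1!inE] Kxt; exact/WC/KT.
have Wyt : W (y, t) < 0.
  by apply: le_lt_trans W0; apply: ytmin; rewrite inE.
have [_ /=] := Kyt; rewrite in_itv/= => /andP[st tt1].
have {}st : s < t.
  rewrite lt_neqAle st andbT; apply/eqP => sE.
  by have := Ws y; rewrite sE; lra.
have {}tt1 : t < t1.
  rewrite lt_neqAle tt1 andbT; apply/eqP => tE.
  by have := Wt1 y; rewrite -tE; lra.
have yR : `|y| < Rad.
  apply: (wR y t); first by rewrite !ltW.
  by move: Wyt; rewrite /W; have := expR_gt0 (n * ((y, t).2 - a)); lra.
exists n, a, y, t; split=> //; first by rewrite st.
have Ky : \forall y' \near y, `|y'| <= Rad.
  exact: (cvgr_norm_le y (@cvg_id _ (nbhs y)) Rad yR).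
have Kt : \forall t' \near t, s <= t' <= t1.
  near=> t'; apply/andP; split; near: t'.
    exact: (cvgr_ge t).
  exact: (cvgr_le t).
exists ([set y' | `|y'| <= Rad], [set t' | s <= t' <= t1]) => //= -[y' t'] /= [Hy Ht].
by apply: ytmin; rewrite inE; split => //=; rewrite in_itv.
Unshelve. all: by end_near.
Qed.

(** * Subsolutions grow at most like the action *)

Lemma moving_dist2E (R : realType) (N : nat) (y v : 'rV[R]_N) (s nu : R)
    (xt : 'rV[R]_N * R) :
  moving_dist2 y v s nu xt = enorm (xt.1 - y - (xt.2 - s) *: v) ^+ 2 + nu.
Proof.
rewrite sqr_enorm; congr (_ + _); apply: eq_bigr => i _.
by rewrite !mxE.
Qed.

Lemma continuous_test_fun (R : realType) (N : nat) (y v : 'rV[R]_N)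
    (s nu k0 al k r m ka n a : R) xt : 0 < nu ->
  {for xt, continuous (test_fun y v s nu k0 al k r m ka n a)}.
Proof.
move=> nu0; apply: differentiable_continuous.
exact: differentiable_test_fun.
Qed.

(** Along the segment from [(y, s)] to [(x, t)], with velocity [v], Young's
    inequality turns the equation into [u_t + v . Du <= K] with
    [K = delta^(p - 1) |v|^p + eta], and every function of [x - y - (t - s) v]
    solves the homogeneous transport equation. So a steep paraboloid moving
    with velocity [v], plus a little more than [K (t - s)], stays above [u]. *)
Lemma subsolution_action_upper (R : realType) (N : nat) (p q delta eta M T : R)
    (H : 'rV[R]_N -> R -> 'rV[R]_N -> R) (u : 'rV[R]_N * R -> R) :
  0 < p -> 0 < q -> p^-1 + q^-1 = 1 -> 0 < delta -> 0 <= eta ->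
  (forall x t z, 0 < t < T -> delta^-1 * enorm z `^ q - eta <= H x t z) ->
  (forall xt, strip T xt -> {for xt, continuous u}) ->
  (forall x t, 0 < t < T -> `|u (x, t)| <= M) ->
  viscosity_subsolution T H u ->
  action_upper p (delta `^ (p - 1)) (eta + 1) T u.
Proof.
move=> p0 q0 pq d0 eta0 Hlow uC uM usub x y s t s0 st tT.
rewrite leNgt; apply/negP => ult.
pose h := t - s; have h0 : 0 < h by rewrite /h; lra.
pose v := h^-1 *: (x - y).
have xyE : x - y = h *: v by rewrite /v scalerA mulfV ?gt_eqF// scale1r.
have [e0 M0] : 0 <= enorm v /\ 0 <= M.
  by split; [exact: enorm_ge0|apply: le_trans (uM x t _)=> //; lra].
pose K := delta `^ (p - 1) * enorm v `^ p + eta + 2^-1.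
have K0 : 0 <= K by rewrite !addr_ge0 ?mulr_ge0 ?powR_ge0.
have sT : strip T (y, s) by rewrite /strip/= s0 (lt_trans st).
have [rho /= rho0 near_y] : exists2 rho : R, 0 < rho &
    forall z, `|z - y| < rho -> u (z, s) <= u (y, s) + h / 2.
  have : \forall z \near y, u (z, s) <= u (y, s) + h / 2.
    have zs : (fun z => (z, s)) @ y --> (y, s).
      exact: (cvg_pair (@cvg_id _ (nbhs y)) (cvg_cst s)).
    apply: (cvgr_le _ (cvg_comp _ _ zs (uC _ sT))).
    by lra.
  move=> /nbhs_ballP[rho/= rho0 ballP]; exists rho => // z zy.
  by apply: ballP; rewrite -ball_normE /= distrC.
(* Steep enough that the paraboloid exceeds the oscillation [2 M] of [u] at
   distance [rho]. *)
pose be := 2 * M / rho ^+ 2.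
pose b := be + 1.
have be0 : 0 <= be by rewrite divr_ge0 ?sqr_ge0// mulr_ge0.
have b0 : 0 < b by rewrite /b; lra.
pose phi ka n a := test_fun y v s 1 (u (y, s) + h / 2 - b) b 0 1 K ka n a.
have phiE ka n a zr : phi ka n a zr = u (y, s) + h / 2
    + b * enorm (zr.1 - y - (zr.2 - s) *: v) ^+ 2 + K * (zr.2 - s)
    + ka * expR (n * (zr.2 - a)).
  rewrite /phi /test_fun mul0r expR0 mulr1 powRr1.
    by rewrite moving_dist2E; ring.
  by apply: ltW; apply: moving_dist2_gt0.
pose w zr := phi 0 0 0 zr - u zr.
pose t1 := (t + T) / 2.
have tt1 : t < t1 by rewrite /t1; lra.
have t1T : t1 < T by rewrite /t1; lra.
have range r : s <= r <= t1 -> 0 < r < T.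
  by move=> /andP[sr rt1]; apply/andP; split; lra.
have wlow z r : s <= r <= t1 ->
    b * enorm (z - y - (r - s) *: v) ^+ 2 - 2 * M <= w (z, r).
  move=> sr; rewrite /w phiE /= mul0r addr0.
  have := uM z r (range r sr); have := uM y s sT.
  have Kr : 0 <= K * (r - s) by rewrite mulr_ge0//; lra.
  by rewrite !ler_norml => /andP[? ?] /andP[? ?]; lra.
have [] := @penalized_min R N T s t t1
  (enorm y + (t1 - s) * enorm v + (2 * M / b + 1)) (2 * M) w x.
- move=> zr Tzr; apply: cvgB; last exact: uC.
  exact: continuous_test_fun.
- by [].
- exact: ltW.
- by [].
- by [].
- by rewrite mulr_ge0.
- move=> z; rewrite /w phiE/= subrr mul0r scale0r subr0 mulr0 !addr0.
  have [/near_y|zy] := ltP `|z - y| rho.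
    have : 0 <= b * enorm (z - y) ^+ 2 by rewrite mulr_ge0 ?sqr_ge0// ltW.
    by lra.
  have : 2 * M <= b * enorm (z - y) ^+ 2.
    have rz : rho ^+ 2 <= enorm (z - y) ^+ 2.
      rewrite ler_pXn2r ?nnegrE ?enorm_ge0// ?(ltW rho0)//.
      exact: le_trans zy (norm_le_enorm _).
    have -> : 2 * M = be * rho ^+ 2 by rewrite /be mulfVK ?gt_eqF ?exprn_gt0.
    apply: ler_pM => //; first exact: sqr_ge0.
    by rewrite /b; lra.
  have /andP[_ tT'] := sT.
  have := uM z s sT; have := uM y s sT.
  by rewrite !ler_norml => /andP[? ?] /andP[? ?]; lra.
- move=> z r sr w0; have := wlow z r sr; move: (sr) => /andP[sr' rt1].
  set d := z - y - _ => dM.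
  have d2 : enorm d ^+ 2 < 2 * M / b by rewrite ltr_pdivlMr// mulrC; lra.
  have d1 : enorm d < 2 * M / b + 1.
    rewrite ltNge; apply/negP => dge; have := ler_wpM2l (enorm_ge0 d) dge.
    by rewrite -expr2 mulrDr mulr1; have := enorm_ge0 d;
       have : 0 <= 2 * M / b by [rewrite divr_ge0 ?mulr_ge0// ltW]; nra.
  have -> : z = y + ((r - s) *: v + d) by rewrite /d [_ *: v + _]addrC subrK addrC subrK.
  apply: le_lt_trans (norm_le_enorm _) _.
  apply: le_lt_trans (enormD _ _) _.
  rewrite -addrA ler_ltD//.
  apply: le_lt_trans (enormD _ _) _.
  rewrite ler_ltD// enormZ ger0_norm ?subr_ge0//.
  by rewrite ler_wpM2r//; lra.
- move=> z r sr; apply: le_trans (wlow z r sr).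
  have : 0 <= b * enorm (z - y - (r - s) *: v) ^+ 2.
    by rewrite mulr_ge0 ?sqr_ge0// ltW.
  by lra.
- rewrite /w phiE/= mul0r addr0 xyE subrr.
  rewrite enorm0 expr0n/= mulr0 !addr0.
  move: ult; rewrite xyE enormZ gtr0_norm// action_scale//.
  by rewrite -/h /K; lra.
move=> n [a [z [r [n0 /andP[sr rt1] locmin]]]].
have zrT : strip T (z, r).
  by have := range r; rewrite (ltW sr) (ltW rt1) => /(_ isT).
have := usub (phi 1 n a) (z, r) (C1_on_test_fun _ _ _ _ _ _ _ _ _ _ _ ltr01 T) zrT.
have locmax : local_max_at (u \- phi 1 n a) (z, r).
  move: locmin; apply: filterS => zr' /=.
  by rewrite /w !phiE/= !mul0r !mul1r; clear; lra.
move=> /(_ locmax); rewrite dert_test_fun// gradx_test_fun//=.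
rewrite mul0r expR0 subrr powRr0 !mulr1 !mul0r sub0r !mul1r.
set d := z - y - _.
rewrite [\sum_i _](_ : _ = \sum_i d ord0 i * v ord0 i); last first.
  by apply: eq_bigr => i _; rewrite !mxE.
have low := Hlow z r ((2 * b) *: d) zrT.
have vd := young d0 p0 q0 pq (enorm_ge0 ((2 * b) *: d)) e0.
have := dot_le_enorm ((2 * b) *: d) v.
have -> : \sum_i ((2 * b) *: d) ord0 i * v ord0 i =
    2 * b * \sum_i d ord0 i * v ord0 i.
  by rewrite mulr_sumr; apply: eq_bigr => i _; rewrite mxE mulrA.
have ne : 0 < n * expR (n * (r - a)) by rewrite mulr_gt0 ?expR_gt0.
have contra (b' e' S Z P G h' g : R) : G - e' <= h' -> Z <= G + P -> 0 < g ->
    2 * b' * S <= Z -> b' * - (2 * S) + (P + e' + 2^-1) + g + h' <= 0 -> False.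
  by clear; lra.
exact: contra low vd ne.
Qed.

(** * Supersolutions grow at least like the action *)

(** The factor [expR (- 2)] pays for the growth of the exponential weight over
    two time units [h]; the rest makes [super_cst_slope] an equality at the
    largest admissible value. *)
Definition super_cst (R : realType) (p q delta : R) : R :=
  expR (- 2) * (delta * p `^ q) `^ (1 - p).

Lemma super_cst_gt0 (R : realType) (p q delta : R) : 0 < p -> 0 < delta ->
  0 < super_cst p q delta.
Proof.
by move=> p0 d0; rewrite mulr_gt0 ?expR_gt0// powR_gt0// mulr_gt0 ?powR_gt0.
Qed.

(** With [- g] the current coefficient of the inverted power, [delta * (p g)^q] is the
    contribution of the gradient and [g / h] that of the time derivative. Since
    [(p - 1) (q - 1) = 1], the powers of [h] match. *)
Lemma super_cst_slope (R : realType) (p q delta h g : R) :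
  1 < p -> 1 < q -> p^-1 + q^-1 = 1 -> 0 < delta -> 0 < h -> 0 < g ->
  g <= super_cst p q delta * h `^ (1 - p) * expR 2 ->
  delta * (p * g) `^ q <= g / h.
Proof.
move=> p1 q1 pq d0 h0 g0 gle.
have pq1 : (1 - p) * (q - 1) = - 1.
  by rewrite mulrBr mulrBl !mulr1 mul1r (conjugate_mul _ _ pq); lra.
have gE : super_cst p q delta * h `^ (1 - p) * expR 2
    = (delta * p `^ q * h) `^ (1 - p).
  have -> : super_cst p q delta * h `^ (1 - p) * expR 2
    = (delta * p `^ q) `^ (1 - p) * h `^ (1 - p) * (expR (- 2) * expR 2).
    by rewrite /super_cst; ring.
  rewrite -expRD addNr expR0 mulr1 -powRM ?(ltW h0)//.
  by rewrite mulr_ge0 ?powR_ge0 ?ltW.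
have k0 : 0 < delta * p `^ q by rewrite mulr_gt0// powR_gt0//; lra.
have gq : g `^ (q - 1) <= (delta * p `^ q * h)^-1.
  have <- : (delta * p `^ q * h) `^ (1 - p) `^ (q - 1) = (delta * p `^ q * h)^-1.
    by rewrite -powRrM pq1 powR_inv1// mulr_ge0 ?(ltW h0) ?(ltW k0).
  rewrite -gE ge0_ler_powR ?nnegrE//; [lra|exact: ltW|].
  by apply: le_trans gle; exact: ltW.
rewrite powRM ?(ltW g0)//; last lra.
rewrite -(@mulr_powRB1 _ g q) ?(ltW g0)//; last lra.
have -> : g / h = delta * p `^ q * g * (delta * p `^ q * h)^-1.
  by field; rewrite !gt_eqF// powR_gt0//; lra.
have -> : delta * (p `^ q * (g * g `^ (q - 1))) =
   delta * p `^ q * g * g `^ (q - 1) by ring.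
by rewrite ler_pM2l// mulr_gt0.
Qed.

Lemma powR_half_sqr (R : realType) (e p : R) : 0 <= e ->
  (e ^+ 2) `^ (p / 2) = e `^ p.
Proof.
move=> e0; rewrite -powR_mulrn// -powRrM; congr (_ `^ _).
by rewrite mulrC mulfVK.
Qed.

(** The equation has the exact solutions [- C (r0 - r)^(1 - p) |z - x|^p], up to
    a linear function of time, but they are singular at [r0]. An exponential
    weight replaces the power of the time to go: it is smooth for all times, and
    on an interval of length [2 h] it costs only a constant factor. Rounding the vertex preserves the inequality because
    [|z - x|] is at most the square root of [Q]. *)
Lemma super_test_lt (R : realType) (N : nat) (p q delta h nu n s r : R)
    (x z : 'rV[R]_N) (k0 a : R) :
  1 < p -> 1 < q -> p^-1 + q^-1 = 1 -> 0 < delta -> 0 < h ->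
  0 <= r - s <= 2 * h -> 0 < nu -> 0 < n -> forall eta al,
  0 < al -> al <= super_cst p q delta * h `^ (1 - p) -> forall phi,
  phi = test_fun x 0 s nu k0 (- al) h^-1 (p / 2) (- (eta + 2^-1)) (- 1) n a ->
  dert phi (z, r) + (delta * enorm (gradx phi (z, r)) `^ q + eta) < 0.
Proof.
move=> p1 q1 pq d0 h0 /andP[sr rs] nu0 n0 eta al al0 alle phi ->{phi}.
set phi := test_fun _ _ _ _ _ _ _ _ _ _ _ _.
pose Q := enorm (z - x) ^+ 2 + nu.
have Q0 : 0 < Q by rewrite ltr_wpDl ?sqr_ge0.
have distE : moving_dist2 x 0 s nu (z, r) = Q.
  by rewrite moving_dist2E/= scaler0 subr0.
have [E [EE E0 E2]] : exists E, [/\ E = expR (h^-1 * (r - s)), 0 < E & E <= expR 2].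
  exists (expR (h^-1 * (r - s))); split; rewrite ?expR_gt0//.
  by rewrite ler_expR mulrC ler_pdivrMr.
have g0 : 0 < al * E by rewrite mulr_gt0.
have gradE : enorm (gradx phi (z, r)) `^ q <= (p * (al * E)) `^ q * Q `^ (p / 2).
  rewrite gradx_test_fun; last exact: nu0.
  rewrite distE enormZ.
  rewrite [in X in _ * enorm X]/=.
  rewrite scaler0 subr0.
  rewrite [(z, r).2]/= -EE.
  have -> : 2 * - al * E * (p / 2) * Q `^ (p / 2 - 1) =
     - (p * (al * E) * Q `^ (p / 2 - 1)) by field.
  have pg0 : 0 <= p * (al * E) by apply: mulr_ge0; lra.
  rewrite normrN ger0_norm; last by apply: mulr_ge0 => //; exact: powR_ge0.
  have -> : Q `^ (p / 2) = (Q `^ ((p - 1) / 2)) `^ q.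
    rewrite -powRrM; congr (_ `^ _).
    by rewrite mulrAC mulrBl (conjugate_mul _ _ pq) ?mul1r ?addrK//; lra.
  rewrite -powRM ?powR_ge0//.
  apply: ge0_ler_powR; first lra.
  - by rewrite nnegrE; apply: mulr_ge0 (enorm_ge0 _); apply: mulr_ge0 (powR_ge0 _ _).
  - by rewrite nnegrE; apply: mulr_ge0 (powR_ge0 _ _).
  rewrite -mulrA; apply: ler_wpM2l => //.
  have -> : (p - 1) / 2 = (p / 2 - 1) + 2^-1 by field.
  rewrite [leRHS]powRD; last by rewrite (gt_eqF Q0) implybT.
  apply: ler_wpM2l; first exact: powR_ge0.
  rewrite powR12_sqrt ?(ltW Q0)//.
  rewrite -[leLHS]ger0_norm ?enorm_ge0// -sqrtr_sqr ler_wsqrtr//.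
  by rewrite /Q lerDl ltW.
have dertE : dert phi (z, r) =
    - (al * E / h) * Q `^ (p / 2) - (eta + 2^-1) - n * expR (n * (r - a)).
  rewrite dert_test_fun; last exact: nu0.
  rewrite distE [(z, r).2]/= -EE [\sum_i _]big1; last first.
    by move=> i _; rewrite mxE mulr0.
  by ring.
have slope : delta * (p * (al * E)) `^ q <= al * E / h.
  apply: (@super_cst_slope _ p q delta h) => //.
  by apply: ler_pM => //; exact: ltW.
have ne : 0 < n * expR (n * (r - a)) by rewrite mulr_gt0 ?expR_gt0.
have := ler_wpM2l (ltW d0) gradE; rewrite mulrA => g1.
have := ler_wpM2r (powR_ge0 Q (p / 2)) slope.
by rewrite dertE; lra.
Qed.

(** If no [y] worked, [u] would lie at time [s] above the inverted power with
    maximum [k0] at [x], hence also afterwards; at [(x, t)] this would force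
    [u (x, t)] to exceed itself. The unit added to [eta] absorbs the
    rounding of the vertex and makes the comparison strict. *)
Lemma supersolution_action_lower (R : realType) (N : nat) (p q delta eta M T : R)
    (H : 'rV[R]_N -> R -> 'rV[R]_N -> R) (u : 'rV[R]_N * R -> R) :
  1 < p -> 1 < q -> p^-1 + q^-1 = 1 -> 0 < delta -> 0 <= eta ->
  (forall x t z, 0 < t < T -> H x t z <= delta * enorm z `^ q + eta) ->
  (forall xt, strip T xt -> {for xt, continuous u}) ->
  (forall x t, 0 < t < T -> `|u (x, t)| <= M) ->
  viscosity_supersolution T H u ->
  action_lower p (super_cst p q delta) (eta + 1) T u.
Proof.
move=> p1 q1 pq d0 eta0 Hup uC uM usup x s t s0 st tT.
apply: contrapT => nex.
pose h := t - s; have h0 : 0 < h by rewrite /h; lra.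
pose c := super_cst p q delta; have c0 : 0 < c.
  by apply: super_cst_gt0 => //; lra.
pose k0 := u (x, t) + (eta + 1) * h.
have low y : k0 < u (y, s) + c * action p h (enorm (y - x)).
  rewrite ltNge; apply/negP => ule; apply: nex; exists y.
  by rewrite enormC; move: ule; rewrite /k0 -/h -/c; lra.
pose al := c * h `^ (1 - p).
have al0 : 0 < al by rewrite mulr_gt0// powR_gt0.
(* Chosen so that rounding the vertex lowers the maximum by at most [h / 4]. *)
pose nu := (h / (4 * (al * expR 2))) `^ (2 / p).
have e20 : 0 < al * expR 2 by rewrite mulr_gt0// expR_gt0.
have nu0 : 0 < nu by rewrite powR_gt0// divr_gt0// mulr_gt0.
have nuE : al * expR 2 * nu `^ (p / 2) = h / 4.
  rewrite /nu -powRrM (_ : 2 / p * (p / 2) = 1); last by field; lra.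
  rewrite powRr1; last by rewrite divr_ge0 ?ltW// mulr_gt0.
  by field; rewrite !gt_eqF// expR_gt0.
have M0 : 0 <= M by apply: le_trans (uM x t _)=> //; lra.
pose K := eta + 2^-1.
pose phi ka n a := test_fun x 0 s nu k0 (- al) h^-1 (p / 2) (- K) ka n a.
pose Q z := enorm (z - x) ^+ 2 + nu.
have Q0 z : 0 < Q z by rewrite ltr_wpDl ?sqr_ge0.
have distE z r : moving_dist2 x 0 s nu (z, r) = Q z.
  by rewrite moving_dist2E/= scaler0 subr0.
have phiE ka n a z r : phi ka n a (z, r) = k0
    - al * expR (h^-1 * (r - s)) * Q z `^ (p / 2) - K * (r - s)
    + ka * expR (n * (r - a)).
  by rewrite /phi /test_fun distE/=; ring.
pose w zr := u zr - phi 0 0 0 zr.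
(* The test function is a strict subsolution up to the time
   [s + 2 h = t + h]. *)
pose t1 := Num.min (t + h) ((t + T) / 2).
have tt1 : t < t1 by rewrite /t1 lt_min; apply/andP; split; lra.
have t1T : t1 < T by rewrite /t1 gt_min; apply/orP; right; lra.
have t1h : t1 <= t + h by rewrite /t1 ge_min lexx.
have range r : s <= r <= t1 -> 0 < r < T.
  by move=> /andP[sr rt1]; apply/andP; split; lra.
have E1 r : s <= r -> 1 <= expR (h^-1 * (r - s)).
  move=> sr; rewrite -expR0 ler_expR mulr_ge0 ?invr_ge0 ?(ltW h0)//; lra.
have E2 r : r <= t1 -> expR (h^-1 * (r - s)) <= expR 2.
  by move=> rt1; rewrite ler_expR mulrC ler_pdivrMr// /h; move: t1h; rewrite /h; lra.
have Qp z : enorm (z - x) `^ p <= Q z `^ (p / 2).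
  rewrite -powR_half_sqr ?enorm_ge0// ge0_ler_powR ?nnegrE ?sqr_ge0//.
  - by rewrite divr_ge0//; lra.
  - exact: ltW.
  - by rewrite /Q lerDl ltW.
have EQ z r : s <= r ->
    al * enorm (z - x) `^ p <= al * expR (h^-1 * (r - s)) * Q z `^ (p / 2).
  move=> sr; rewrite -mulrA; apply: ler_wpM2l; first exact: ltW.
  apply: (le_trans (Qp z)).
  by apply: ler_peMl; [exact: powR_ge0|exact: E1].
pose L := M + `|k0|.
have wlow z r : s <= r <= t1 -> al * enorm (z - x) `^ p - L <= w (z, r).
  move=> sr; rewrite /w phiE /= mul0r addr0.
  have := uM z r (range r sr); have := ler_norm k0.
  move/andP: sr => [sr _]; have := EQ z r sr.
  have Kr : 0 <= K * (r - s) by rewrite mulr_ge0 /K//; lra.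
  by rewrite ler_norml /L => ? ? /andP[? ?]; lra.
have [] := @penalized_min R N T s t t1 (enorm x + (L / al + 1)) L w x.
- move=> zr Tzr; apply: cvgB; first exact: uC.
  exact: continuous_test_fun.
- by [].
- exact: ltW.
- by [].
- by [].
- by rewrite addr_ge0.
- move=> z; rewrite /w phiE/= subrr !mulr0 expR0 mul0r !addr0 mulr1 subr0.
  have := low z; have := EQ z s (lexx _).
  rewrite subrr mulr0 expR0 mulr1 /action /al; lra.
- move=> z r sr w0; have := wlow z r sr => dM.
  have d2 : enorm (z - x) `^ p < L / al by rewrite ltr_pdivlMr// mulrC; lra.
  have d1 : enorm (z - x) < L / al + 1.
    rewrite ltNge; apply/negP => dge.
    have La : 0 <= L / al by rewrite divr_ge0 ?addr_ge0// ltW.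
    have : enorm (z - x) <= enorm (z - x) `^ p.
      by apply: le1r_powR; [lra|exact: ltW].
    by lra.
  have -> : z = x + (z - x) by rewrite addrC subrK.
  apply: le_lt_trans (norm_le_enorm _) _.
  apply: le_lt_trans (enormD _ _) _.
  by rewrite ler_ltD.
- move=> z r sr; apply: le_trans (wlow z r sr).
  have : 0 <= al * enorm (z - x) `^ p by rewrite mulr_ge0 ?powR_ge0// ltW.
  by lra.
- rewrite /w phiE/= mul0r addr0 /Q subrr.
  rewrite enorm0 expr0n/= add0r.
  have : al * expR (h^-1 * (t - s)) * nu `^ (p / 2) <= h / 4.
    rewrite -nuE ler_wpM2r ?powR_ge0// ler_pM2l//.
    by apply: E2; exact: ltW.
  by rewrite /k0 /K -/h; lra.
move=> n [a [z [r [n0 /andP[sr rt1] locmin]]]].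
have zrT : strip T (z, r).
  by have := range r; rewrite (ltW sr) (ltW rt1) => /(_ isT).
have := usup (phi (- 1) n a) (z, r) (C1_on_test_fun _ _ _ _ _ _ _ _ _ _ _ nu0 T) zrT.
have locmin_u : local_min_at (u \- phi (- 1) n a) (z, r).
  move: locmin; apply: filterS => -[z' r'] /=.
  by rewrite /w !phiE/= !mul0r; clear; lra.
move=> /(_ locmin_u).
have Er : 0 <= r - s <= 2 * h.
  by apply/andP; split; [lra|move: t1h; rewrite /h; lra].
have strict := @super_test_lt R N p q delta h nu n s r x z k0 a p1 q1 pq d0 h0 Er
  nu0 n0 eta al al0 (lexx _) (phi (- 1) n a) erefl.
have := Hup z r (gradx (phi (- 1) n a) (z, r)) zrT.
by move: strict; lra.
Qed.

(** * Geometric decay of the action along backward chains *)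

(** A rate strictly below [1] leaves room for a small positive power of the
    ratio of scales: this is where the gain in the exponent comes from. *)
Lemma exists_small_exponent (R : realType) (mu La : R) :
  0 < mu < 1 -> 1 < La -> exists ga : R, 0 < ga < 1 /\ mu * La `^ ga < 1.
Proof.
move=> /andP[mu0 mu1] La1; pose nu := (1 + mu) / 2 / mu.
have nu1 : 1 < nu by rewrite /nu ltr_pdivlMr//; lra.
have lnLa : 0 < ln La by rewrite ln_gt0.
have lnnu : 0 < ln nu by rewrite ln_gt0.
exists (Num.min 2^-1 (ln nu / ln La)); split.
  rewrite lt_min invr_gt0 ltr0n divr_gt0//= gt_min; apply/orP; left; lra.
apply: (@le_lt_trans _ _ (mu * nu)); last first.
  by rewrite /nu mulrC mulfVK ?gt_eqF//; lra.
rewrite ler_pM2l//; apply: (@le_trans _ _ (La `^ (ln nu / ln La))).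
  by rewrite ler_powR ?(ltW La1)// ge_min lexx orbT.
rewrite /powR gt_eqF; last by lra.
by rewrite mulfVK ?gt_eqF// lnK// posrE; lra.
Qed.

Lemma expn_unbounded (R : realType) (La h b : R) :
  1 < La -> 0 < h -> exists n, b < La ^+ n.+1 * h.
Proof.
move=> La1 h0.
have [n bn] : exists n : nat, b / h / (La - 1) < n%:R.
  by exists (Num.truncn (b / h / (La - 1))).+1; exact: truncnS_gt.
exists n; rewrite -ltr_pdivrMr//.
rewrite ltr_pdivrMr in bn; last by lra.
apply: (lt_trans bn).
have : 1 + (n.+1)%:R * (La - 1) <= La ^+ n.+1.
  elim: (n.+1) => [|k IH]; first by rewrite mul0r addr0 expr0.
  rewrite exprS; apply: le_trans (ler_wpM2l _ IH); last by lra.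
  rewrite -(natr1 k).
  have : 0 <= k%:R * (La - 1) * (La - 1) by rewrite !mulr_ge0 ?ler0n//; lra.
  by lra.
by rewrite -natr1; lra.
Qed.

(** A chain going back from [(x, t)] to [(y, t - h)] is remembered only through
    a bound [E] for its total action. *)
Definition chain (R : realType) N (p c eta : R) (u : 'rV[R]_N * R -> R)
    (x : 'rV[R]_N) (t h E : R) (y : 'rV[R]_N) :=
  action p h (enorm (x - y)) <= E /\ u (y, t - h) + c * E - eta * h <= u (x, t).

Section Chains.
Variables (R : realType) (N : nat).
Implicit Types (p A c eta T t h E k : R) (u : 'rV[R]_N * R -> R).

Lemma chain_start p c eta T u x t h : action_lower p c eta T u ->
  0 < h -> h < t -> t < T -> exists y E, chain p c eta u x t h E y.
Proof.
move=> u_lower h0 ht tT; have [|||y] := u_lower x (t - h) t; [lra..|].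
have -> : t - (t - h) = h by ring.
by exists y, (action p h (enorm (x - y))).
Qed.

Lemma chain_extend p c eta T u x t h E y k :
  1 < p -> action_lower p c eta T u -> 0 < h -> h < k -> k < t -> t < T ->
  chain p c eta u x t h E y -> exists E' y', chain p c eta u x t k E' y' /\
    E + action p (k - h) (enorm (y - y')) = E'.
Proof.
move=> p1 u_lower h0 hk kt tT [actE uE].
have [|||y' uy'] := u_lower y (t - k) (t - h); [lra..|].
have dE : t - h - (t - k) = k - h by ring.
rewrite dE in uy'.
exists (E + action p (k - h) (enorm (y - y'))), y'; split=> //; split.
  have kE : k = h + (k - h) by ring.
  have hk0 : 0 < k - h by lra.
  apply: (@le_trans _ _ (action p (h + (k - h))
      (enorm (x - y) + enorm (y - y')))).
    rewrite -kE; apply: ler_action; [|exact: enorm_ge0|exact: enorm_triangle].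
    exact: le_trans ler01 (ltW p1).
  apply: le_trans (actionD (ltW p1) h0 hk0 (enorm_ge0 _) (enorm_ge0 _)) _.
  by rewrite lerD2r.
by lra.
Qed.

(** The gain [c * E] along the chain cannot exceed the growth allowed along the
    segment joining its end points. *)
Lemma chain_action_le p A c eta T u x t h E y :
  action_upper p A eta T u -> 0 < h -> h < t -> t < T ->
  chain p c eta u x t h E y ->
  c * E <= A * action p h (enorm (x - y)) + 2 * eta * h.
Proof.
move=> u_upper h0 ht tT [_ uE].
have := u_upper x y (t - h) t.
have -> : t - (t - h) = h by ring.
have th0 : 0 < t - h by lra.
have tht : t - h < t by lra.
by move=> /(_ th0 tht tT); lra.
Qed.

End Chains.

Section Constants.
Variables (R : realType) (p A c eta : R).

(** [action_ratio] compares the two action constants, with the factor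
    [2 ^ (p - 1)] from the convexity of the power. [time_ratio] is then the
    ratio of successive times at which spreading a displacement over the
    longer time divides its action by [2 * action_ratio]
    ([time_ratio_powR]); [decay_rate] and [decay_error] come from solving the
    resulting inequality for the shorter chain ([chain_decay]). *)
Definition action_ratio := 2 `^ (p - 1) * A / c + 1.
Definition time_ratio := (2 * action_ratio) `^ (p - 1)^-1.
Definition decay_rate := (action_ratio - 1) / (action_ratio - 2^-1).
Definition decay_error := 2 * eta / c / (action_ratio - 2^-1).

Lemma action_ratio_gt1 : 0 < A -> 0 < c -> 1 < action_ratio.
Proof.
by move=> A0 c0; rewrite ltrDr divr_gt0// mulr_gt0// powR_gt0.
Qed.

Lemma time_ratio_gt1 : 1 < p -> 0 < A -> 0 < c -> 1 < time_ratio.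
Proof.
move=> p1 A0 c0; have B1 := action_ratio_gt1 A0 c0.
rewrite -[X in X < _](powRr0 (2 * action_ratio)) /time_ratio.
rewrite /powR gt_eqF; last by lra.
rewrite ltr_expR ltr_pM2r; first by rewrite invr_gt0; lra.
by apply: ln_gt0; lra.
Qed.

Lemma time_ratio_powR : 1 < p -> 0 < A -> 0 < c ->
  action_ratio * time_ratio `^ (1 - p) = 2^-1.
Proof.
move=> p1 A0 c0; have B1 := action_ratio_gt1 A0 c0.
rewrite /time_ratio -powRrM (_ : (p - 1)^-1 * (1 - p) = -1); last by field; lra.
by rewrite powR_inv1; [field; lra|lra].
Qed.

Lemma decay_rate_itv : 0 < A -> 0 < c -> 0 < decay_rate < 1.
Proof.
move=> A0 c0; have B1 := action_ratio_gt1 A0 c0.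
rewrite /decay_rate divr_gt0/=; [|lra|lra].
by rewrite ltr_pdivrMr; lra.
Qed.

Lemma decay_error_ge0 : 0 < A -> 0 < c -> 0 <= eta -> 0 <= decay_error.
Proof.
move=> A0 c0 eta0; have B1 := action_ratio_gt1 A0 c0.
by rewrite !divr_ge0 ?mulr_ge0 ?(ltW c0)//; lra.
Qed.

End Constants.

(** Splitting the displacement of the extended chain into the old part, now
    spread over a longer time, and the new part, and using [chain_action_le] for
    the whole, gives [E' <= E / 2 + B * (E' - E) + O(La h)]. If [E'] were close to
    [E], the right-hand side would be close to [E' / 2]; so a fixed fraction of
    [E'] comes from the new part. *)
Lemma chain_decay (R : realType) N (p A c eta T : R) (u : 'rV[R]_N * R -> R)
    x t h E y :
  let La := time_ratio p A c in
  1 < p -> 0 < A -> 0 < c -> action_upper p A eta T u -> action_lower p c eta T u ->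
  0 < h -> La * h < t -> t < T -> chain p c eta u x t h E y ->
  exists E' y', chain p c eta u x t (La * h) E' y' /\
    E <= decay_rate p A c * E' + decay_error p A c eta * (La * h).
Proof.
move=> La p1 A0 c0 u_upper u_lower h0 Lht tT ch.
have La1 : 1 < La by exact: time_ratio_gt1.
have B1 := action_ratio_gt1 p A0 c0.
have La_powR : action_ratio p A c * La `^ (1 - p) = 2^-1 by exact: time_ratio_powR.
set B := action_ratio p A c in B1 La_powR.
have hL : h < La * h by rewrite ltr_pMl.
have [E' [y' [ch' EE']]] := chain_extend p1 u_lower h0 hL Lht tT ch.
exists E', y'; split => //.
have Lh0 : 0 < La * h by lra.
have cE' := chain_action_le u_upper Lh0 Lht tT ch'.
have act : action p (La * h) (enorm (x - y')) <=
    2 `^ (p - 1) * (La `^ (1 - p) * E + (E' - E)).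
  apply: (@le_trans _ _ (action p (La * h) (enorm (x - y) + enorm (y - y')))).
    apply: ler_action; [exact: le_trans ler01 (ltW p1)|exact: enorm_ge0|].
    exact: enorm_triangle.
  rewrite /action; apply: (@le_trans _ _ (2 `^ (p - 1) *
    (enorm (x - y) `^ p + enorm (y - y') `^ p) * (La * h) `^ (1 - p))).
    apply: ler_wpM2r; first exact: powR_ge0.
    by apply: powR_addr_le; [exact: ltW|exact: enorm_ge0..].
  rewrite -mulrA ler_pM2l ?powR_gt0// mulrDl; apply: lerD.
    rewrite powRM ?(ltW h0)//; last lra.
    rewrite mulrCA ler_wpM2l ?powR_ge0//; exact: ch.1.
  rewrite -EE' [E + _]addrC addrK /action ler_wpM2l ?powR_ge0//.
  rewrite -(opprB p 1) !powRN lef_pV2 ?posrE ?powR_gt0//; last by lra.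
  rewrite ge0_ler_powR ?nnegrE//; lra.
have br0 : 0 <= La `^ (1 - p) * E + (E' - E).
  have E0 : 0 <= E by apply: le_trans (action_ge0 _ _ _) ch.1.
  rewrite addr_ge0 ?mulr_ge0 ?powR_ge0// subr_ge0 -EE' lerDl.
  exact: action_ge0.
have E'le : E' <= B * (La `^ (1 - p) * E + (E' - E)) + 2 * eta / c * (La * h).
  have cB : c * B = 2 `^ (p - 1) * A + c.
    by rewrite /B /action_ratio; field; rewrite gt_eqF.
  rewrite -(ler_pM2l c0); apply: (le_trans cE').
  set br := (_ + (E' - E)) in act br0 *.
  have -> : c * (B * br + 2 * eta / c * (La * h)) =
      (c * B) * br + 2 * eta * (La * h) by field; rewrite gt_eqF.
  rewrite cB lerD2r mulrDl; have := ler_wpM2l (ltW A0) act.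
  have := mulr_ge0 (ltW c0) br0; lra.
rewrite mulrDr mulrA La_powR in E'le.
have b0 : 0 < B - 2^-1 by lra.
rewrite -(ler_pM2l b0) /decay_rate /decay_error -/B.
have -> : (B - 2^-1) * ((B - 1) / (B - 2^-1) * E'
   + 2 * eta / c / (B - 2^-1) * (La * h)) =
   (B - 1) * E' + 2 * eta / c * (La * h).
  by field; apply/andP; split; rewrite gt_eqF//; lra.
lra.
Qed.

(** Induction on the number of scales between [h] and [hb]. At the largest scale
    [E] is bounded because [u] is; going down one scale, the second condition on
    [X] leaves room for the error term. *)
Lemma chain_action_small (R : realType) N (p A c eta M T ga X hb : R)
    (u : 'rV[R]_N * R -> R) x t :
  let La := time_ratio p A c in
  1 < p -> 0 < A -> 0 < c -> 0 <= eta -> 0 <= M ->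
  (forall x t, 0 < t < T -> `|u (x, t)| <= M) ->
  action_upper p A eta T u -> action_lower p c eta T u ->
  0 < ga < 1 -> 0 <= X -> 0 < hb <= 1 -> hb < t -> t < T ->
  (2 * M + eta) / c * (La / hb) `^ ga <= X ->
  decay_error p A c eta * La <= X * (1 - decay_rate p A c * La `^ ga) ->
  forall n h E y, 0 < h <= hb -> hb < La ^+ n.+1 * h ->
  chain p c eta u x t h E y -> E <= X * h `^ ga.
Proof.
move=> La p1 A0 c0 eta0 M0 uM u_upper u_lower /andP[ga0 ga1] X0 /andP[hb0 hb1]
  hbt tT XM Xd.
have La1 : 1 < La by exact: time_ratio_gt1.
have base h E y : 0 < h <= hb -> hb < La * h -> chain p c eta u x t h E y ->
    E <= X * h `^ ga.
  move=> /andP[h0 hhb] hbL [_ ch].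
  have th : 0 < t - h < T by apply/andP; split; lra.
  have tT' : 0 < t < T by apply/andP; split; lra.
  have hpos : 0 < La / hb by rewrite divr_gt0//; lra.
  have E1 : E <= (2 * M + eta) / c.
    rewrite ler_pdivlMr// mulrC.
    have := uM x t tT'; have := uM y (t - h) th.
    have : eta * h <= eta * 1 by apply: ler_wpM2l => //; lra.
    by rewrite mulr1 !ler_norml => ? /andP[? ?] /andP[? ?]; lra.
  apply: (le_trans E1); have eM : 0 <= (2 * M + eta) / c.
    by rewrite divr_ge0 ?(ltW c0)//; lra.
  apply: le_trans (ler_wpM2r (powR_ge0 h ga) XM).
  set k := (_ / c) in eM *.
  rewrite -[X in _ <= X]mulrA -powRM ?(ltW h0) ?(ltW hpos)//; apply: ler_peMr => //.
  rewrite -(powRr0 (La / hb * h)) ler_powR ?(ltW ga0)//.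
  by rewrite mulrAC ler_pdivlMr// mul1r ltW.
elim=> [|n IH] h E y hh; first by rewrite expr1; exact: base.
move=> hbn ch; have [hbL|Lhb] := ltP hb (La * h); first exact: base hbL ch.
have /andP[h0 hhb] := hh.
have Lh0 : 0 < La * h by rewrite mulr_gt0//; lra.
have [|E' [y' [ch' EE']]] := chain_decay p1 A0 c0 u_upper u_lower h0 _ tT ch.
  exact: le_lt_trans Lhb hbt.
have /IH : 0 < La * h <= hb by rewrite Lh0.
rewrite mulrA -exprSr => /(_ _ _ hbn ch') E'le.
have /andP[mu0 mu1] := decay_rate_itv p A0 c0.
have Lhga : La * h <= La * h `^ ga.
  rewrite ler_pM2l; last lra.
  rewrite -[leLHS](powRr1 (ltW h0)).
  by apply: ger_powR; [rewrite h0 (le_trans hhb)|exact: ltW].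
apply: (le_trans EE').
have step1 := ler_wpM2l (ltW mu0) E'le.
have step2 := ler_wpM2l (decay_error_ge0 p A0 c0 eta0) Lhga.
apply: (le_trans (lerD step1 step2)).
rewrite powRM ?(ltW h0)//; last lra.
have := ler_wpM2r (powR_ge0 h ga) Xd; lra.
Qed.

Lemma short_step (R : realType) N (p A c eta M T ga X hb : R)
    (u : 'rV[R]_N * R -> R) x t h :
  let La := time_ratio p A c in
  1 < p -> 0 < A -> 0 < c -> 0 <= eta -> 0 <= M ->
  (forall x t, 0 < t < T -> `|u (x, t)| <= M) ->
  action_upper p A eta T u -> action_lower p c eta T u ->
  0 < ga < 1 -> 0 <= X -> 0 < hb <= 1 -> hb < t -> t < T ->
  (2 * M + eta) / c * (La / hb) `^ ga <= X ->
  decay_error p A c eta * La <= X * (1 - decay_rate p A c * La `^ ga) ->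
  0 < h <= hb ->
  exists y, action p h (enorm (x - y)) <= X * h `^ ga /\
    u (y, t - h) - eta * h <= u (x, t).
Proof.
move=> La p1 A0 c0 eta0 M0 uM u_upper u_lower ga01 X0 hb01 hbt tT XM Xd
  /[dup] hh /andP[h0 hhb].
have [|y [E ch]] := @chain_start R N p c eta T u x t h u_lower h0 _ tT.
  exact: le_lt_trans hbt.
have [n hbn] := expn_unbounded hb (time_ratio_gt1 p1 A0 c0) h0.
have E0 : 0 <= E by apply: le_trans (action_ge0 _ _ _) ch.1.
exists y; split.
  apply: le_trans ch.1 _.
  exact: (chain_action_small p1 A0 c0 eta0 M0 uM u_upper u_lower ga01 X0 hb01
    hbt tT XM Xd hh hbn ch).
by apply: le_trans ch.2; have := mulr_ge0 (ltW c0) E0; lra.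
Qed.

(** * Hoelder estimates *)

(** Compares [u (x', t)] with [u (x, t)] through the point [y] of [short_step]
    for [(x, t)]: the upper bound from [(y, t - h)] to [(x', t)] has length at most
    [|x - x'| + |x - y|], and the time step [h] balances the two terms. *)
Lemma holder_space (R : realType) N (p A eta M T ga X hb : R)
    (u : 'rV[R]_N * R -> R) x x' t :
  1 < p -> 0 < A -> 0 <= eta -> 0 <= M ->
  (forall x t, 0 < t < T -> `|u (x, t)| <= M) -> action_upper p A eta T u ->
  0 < ga < 1 -> 0 <= X -> 0 < hb <= 1 -> hb < t -> t < T ->
  (forall h, 0 < h <= hb -> exists y,
    action p h (enorm (x - y)) <= X * h `^ ga /\ u (y, t - h) - eta * h <= u (x, t)) ->
  u (x', t) - u (x, t) <=
    (2 * eta + A * 2 `^ (p - 1) * (1 + X) + 2 * M / hb `^ ga)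
      * enorm (x - x') `^ (ga * p / (p - 1 + ga)).
Proof.
move=> p1 A0 eta0 M0 uM u_upper /andP[ga0 ga1] X0 /andP[hb0 hb1] hbt tT step.
set r := enorm (x - x').
have tT' : 0 < t < T by apply/andP; split; lra.
have hbg0 : 0 < hb `^ ga by exact: powR_gt0.
have C0 : 0 <= 2 * eta + A * 2 `^ (p - 1) * (1 + X).
  by rewrite addr_ge0 ?mulr_ge0 ?powR_ge0// ?(ltW A0)//; lra.
have [r0|r_neq0] := eqVneq r 0.
  have -> : x' = x.
    apply/eqP; rewrite eq_sym -subr_eq0 -normr_eq0 eq_le normr_ge0 andbT.
    by rewrite -r0; exact: norm_le_enorm.
  rewrite subrr mulr_ge0 ?powR_ge0// addr_ge0// divr_ge0 ?powR_ge0//.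
  by rewrite mulr_ge0.
have r0 : 0 < r by rewrite lt_neqAle eq_sym r_neq0 enorm_ge0.
have k0 : 0 < p - 1 + ga by lra.
have [h [h0 hga rpE]] : exists h, [/\ 0 < h,
    r `^ (ga * p / (p - 1 + ga)) = h `^ ga & r `^ p = h `^ (p - 1 + ga)].
  exists (r `^ (p / (p - 1 + ga))); split; first exact: powR_gt0.
    by rewrite -powRrM; congr (_ `^ _); field; rewrite gt_eqF.
  by rewrite -powRrM; congr (_ `^ _); field; rewrite gt_eqF.
rewrite hga; have hga0 : 0 < h `^ ga by exact: powR_gt0.
have [hhb|hbh] := leP h hb; last first.
  have : 2 * M <= 2 * M / hb `^ ga * h `^ ga.
    rewrite mulrAC ler_pdivlMr//; apply: ler_wpM2l; first lra.
    by rewrite ge0_ler_powR ?nnegrE// ltW.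
  have := mulr_ge0 C0 (ltW hga0).
  have := uM x t tT'; have := uM x' t tT'.
  by rewrite !ler_norml => /andP[? ?] /andP[? ?]; lra.
have [|y [act uy]] := step h; first by rewrite h0.
have up := u_upper x' y (t - h) t.
have tE : t - (t - h) = h by ring.
have th0 : 0 < t - h by rewrite subr_gt0 (le_lt_trans hhb).
have tht : t - h < t by rewrite gtrBl.
rewrite tE in up; have {}up := up th0 tht tT.
have rp : action p h r = h `^ ga.
  rewrite /action rpE -powRD; last by rewrite (gt_eqF h0) implybT.
  by congr (_ `^ _); ring.
have act' : action p h (enorm (x' - y)) <= 2 `^ (p - 1) * ((1 + X) * h `^ ga).
  apply: (@le_trans _ _ (action p h (r + enorm (x - y)))).
    apply: ler_action; [exact: le_trans ler01 (ltW p1)|exact: enorm_ge0|].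
    by rewrite /r [enorm (x - x')]enormC; exact: enorm_triangle.
  apply: (@le_trans _ _ (2 `^ (p - 1) * (action p h r + action p h (enorm (x - y))))).
    rewrite /action -mulrDl mulrA; apply: ler_wpM2r; first exact: powR_ge0.
    by apply: powR_addr_le; [exact: ltW|exact: enorm_ge0..].
  apply: ler_wpM2l; first exact: powR_ge0.
  by rewrite rp mulrDl mul1r lerD2l.
have hle : h <= h `^ ga.
  rewrite -[leLHS](powRr1 (ltW h0)).
  by apply: ger_powR; [rewrite h0 (le_trans hhb)|exact: ltW].
have e1 := ler_wpM2l eta0 hle.
have e2 := ler_wpM2l (ltW A0) act'.
have e3 : 0 <= 2 * M / hb `^ ga * h `^ ga.
  by rewrite mulr_ge0 ?divr_ge0 ?mulr_ge0 ?powR_ge0.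
clear -uy up e1 e2 e3; lra.
Qed.

(** The upper bound with equal end points in space controls the growth of [u] in
    time; its decrease is controlled through the point [y] reached at time [s] and the
    estimate in space between [x] and [y]. *)
Lemma holder_time (R : realType) N (p A eta M T ga X hb Cx : R)
    (u : 'rV[R]_N * R -> R) x t s :
  1 < p -> 0 < A -> 0 <= eta -> 0 <= M ->
  (forall x t, 0 < t < T -> `|u (x, t)| <= M) -> action_upper p A eta T u ->
  0 < ga < 1 -> 0 <= X -> 0 < hb <= 1 -> 0 < s -> s < t -> t < T -> 0 <= Cx ->
  (forall h, 0 < h <= hb -> exists y,
    action p h (enorm (x - y)) <= X * h `^ ga /\ u (y, t - h) - eta * h <= u (x, t)) ->
  (forall y, u (x, s) - u (y, s)
     <= Cx * enorm (x - y) `^ (ga * p / (p - 1 + ga))) ->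
  `|u (x, t) - u (x, s)| <=
    (eta + Cx * (1 + X) + 2 * M / hb `^ ga) * (t - s) `^ ga.
Proof.
move=> p1 A0 eta0 M0 uM u_upper /andP[ga0 ga1] X0 /andP[hb0 hb1] s0 st tT Cx0 step hx.
have tT' : 0 < t < T by apply/andP; split; lra.
have sT' : 0 < s < T by apply/andP; split; lra.
have hbg0 : 0 < hb `^ ga by exact: powR_gt0.
set h := t - s; have h0 : 0 < h by rewrite /h; lra.
have hga0 : 0 < h `^ ga by exact: powR_gt0.
have k0 : 0 < p - 1 + ga by lra.
have CX0 : 0 <= Cx * (1 + X) by rewrite mulr_ge0//; lra.
have c1 := mulr_ge0 CX0 (ltW hga0).
have c2 := mulr_ge0 eta0 (ltW hga0).
have c3 : 0 <= 2 * M / hb `^ ga * h `^ ga.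
  by rewrite mulr_ge0 ?divr_ge0 ?mulr_ge0 ?powR_ge0.
have [hhb|hbh] := leP h hb; last first.
  have : 2 * M <= 2 * M / hb `^ ga * h `^ ga.
    rewrite mulrAC ler_pdivlMr//; apply: ler_wpM2l; first lra.
    by rewrite ge0_ler_powR ?nnegrE// ltW.
  have := uM x t tT'; have := uM x s sT'.
  by rewrite !ler_norml => /andP[? ?] /andP[? ?] ?; apply/andP; split; lra.
have hle : h <= h `^ ga.
  rewrite -[leLHS](powRr1 (ltW h0)).
  by apply: ger_powR; [rewrite h0 (le_trans hhb)|exact: ltW].
have e1 := ler_wpM2l eta0 hle.
have up := u_upper x x s t s0 st tT.
rewrite subrr enorm0 in up.
rewrite {1}/action powR0 ?mul0r ?mulr0 ?addr0 -/h in up; last by lra.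
have [|y [act uy]] := step h; first by rewrite h0.
have tsE : t - h = s by rewrite /h; ring.
rewrite tsE in uy.
have dist : enorm (x - y) `^ (ga * p / (p - 1 + ga)) <= (1 + X) * h `^ ga.
  have dp : enorm (x - y) `^ p <= X * h `^ (p - 1 + ga).
    rewrite powRD; last by rewrite (gt_eqF h0) implybT.
    rewrite [h `^ (p - 1) * _]mulrC mulrA.
    have -> : enorm (x - y) `^ p = action p h (enorm (x - y)) * h `^ (p - 1).
      rewrite /action -mulrA -powRD; last by rewrite (gt_eqF h0) implybT.
      by rewrite (_ : 1 - p + (p - 1) = 0) ?powRr0 ?mulr1//; ring.
    by apply: ler_wpM2r; first exact: powR_ge0.
  rewrite (_ : ga * p / (p - 1 + ga) = p * (ga / (p - 1 + ga))); last by field; lra.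
  rewrite powRrM.
  have g0 : 0 <= ga / (p - 1 + ga) by rewrite divr_ge0// ltW.
  apply: (@le_trans _ _ ((X * h `^ (p - 1 + ga)) `^ (ga / (p - 1 + ga)))).
    apply: ge0_ler_powR => //; rewrite nnegrE; first exact: powR_ge0.
    by apply: mulr_ge0 => //; exact: powR_ge0.
  rewrite powRM ?powR_ge0// -powRrM.
  rewrite (_ : (p - 1 + ga) * (ga / (p - 1 + ga)) = ga); last by field; lra.
  apply: ler_wpM2r; first exact: powR_ge0.
  apply: (@le_trans _ _ ((1 + X) `^ (ga / (p - 1 + ga)))).
    by apply: ge0_ler_powR => //; rewrite ?nnegrE ?lerDr ?addr_ge0.
  rewrite -[leRHS]powRr1 ?addr_ge0//.
  apply: ler_powR; first by rewrite lerDl.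
  by rewrite ler_pdivrMr// mul1r lerDr subr_ge0 ltW.
have e2 := ler_wpM2l Cx0 dist; have e3 := hx y.
by clear -uy up e1 e2 e3 c1 c2 c3; rewrite ler_norml; apply/andP; split; lra.
Qed.

(** * Estimates up to the final time *)

Lemma open_strip (R : realType) (N : nat) (T : R) : open (@strip R N T).
Proof.
rewrite (_ : @strip R N T = snd @^-1` `]0, T[%classic); last first.
  by apply/seteqP; split=> xt; rewrite /strip/= in_itv.
by apply: open_comp => [xt _|]; [exact: cvg_snd|exact: itv_open].
Qed.

Lemma strip_continuous_at (R : realType) (N : nat) (T : R)
    (u : 'rV[R]_N * R -> R) :
  {within @strip R N T, continuous u} ->
  forall xt, strip T xt -> {for xt, continuous u}.
Proof.
move=> uC xt Txt; move: uC.
by rewrite continuous_open_subspace; [apply; rewrite inE|exact: open_strip].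
Qed.

(** The estimates are proved for times before [T], and the bound on [u] is given
    there only; replacing the times by their minimum with [T - d] and letting
    [d] vanish reaches the final time. *)
Lemma continuous_time_clamp (R : realType) (N : nat) (T : R)
    (u : 'rV[R]_N * R -> R) (x : 'rV[R]_N) (t e : R) :
  {within [set xt : 'rV[R]_N * R | 0 <= xt.2 <= T], continuous u} ->
  0 < t <= T -> 0 < e -> exists d : R, 0 < d /\ forall d', 0 < d' -> d' <= d ->
    `|u (x, t) - u (x, Num.min t (T - d'))| <= e.
Proof.
move=> uC /andP[t0 tT] e0.
have At : [set xt : 'rV[R]_N * R | 0 <= xt.2 <= T] (x, t) by rewrite /= tT ltW.
have := (subspace_continuousP _ u).1 uC _ At.
move=> /cvgrPdist_le/(_ e e0)/nbhs_ballP[d/= d0 ballP].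
exists (Num.min (d / 2) (t / 2)).
split; first by rewrite lt_min !divr_gt0.
move=> d' d'0; rewrite le_min => /andP[d'd d't].
have clamp : t - d' <= Num.min t (T - d') <= t.
  by rewrite ge_min lexx/= le_min; apply/andP; split; lra.
move/andP: clamp => [c1 c2].
apply: ballP; last by rewrite /= (le_trans c2 tT) andbT; lra.
split; first exact: ballxx.
by rewrite /ball/= ger0_norm; lra.
Qed.

Lemma dist_min_le (R : realType) (t s k : R) :
  `|Num.min t k - Num.min s k| <= `|t - s|.
Proof.
wlog st : t s / s <= t => [hw|].
  have [st|/ltW ts] := leP s t; first exact: hw.
  by rewrite distrC [leRHS]distrC; exact: hw.
rewrite [leRHS]ger0_norm ?subr_ge0// ger0_norm.
  by case: (leP t k) => tk; case: (leP s k) => sk; lra.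
by rewrite subr_ge0; case: (leP t k) => tk; case: (leP s k) => sk; lra.
Qed.

Lemma holder_closure (R : realType) (N : nat) (T tau C al be : R)
    (u : 'rV[R]_N * R -> R) :
  {within [set xt : 'rV[R]_N * R | 0 <= xt.2 <= T], continuous u} ->
  0 < tau <= T -> 0 <= C -> 0 <= be ->
  (forall x y t s, tau / 2 <= t < T -> tau / 2 <= s < T ->
    `|u (x, t) - u (y, s)| <= C * (enorm (x - y) `^ al + `|t - s| `^ be)) ->
  forall x y t s, tau <= t <= T -> tau <= s <= T ->
    `|u (x, t) - u (y, s)| <= C * (enorm (x - y) `^ al + `|t - s| `^ be).
Proof.
move=> uC /andP[tau0 tauT] C0 be0 holder x y t s /andP[t1 t2] /andP[s1 s2].
apply/ler_addgt0Pl => e e0.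
have e2 : 0 < e / 2 by rewrite divr_gt0.
have tT : 0 < t <= T by apply/andP; split; lra.
have sT : 0 < s <= T by apply/andP; split; lra.
have [dt [dt0 Ht]] := continuous_time_clamp x uC tT e2.
have [ds [ds0 Hs]] := continuous_time_clamp y uC sT e2.
pose d := Num.min (Num.min dt ds) (tau / 2).
have d0 : 0 < d by rewrite /d !lt_min dt0 ds0 divr_gt0.
have ddt : d <= dt by rewrite /d !ge_min lexx.
have dds : d <= ds by rewrite /d !ge_min lexx orbT.
have dtau : d <= tau / 2 by rewrite /d !ge_min lexx !orbT.
have {}Ht := Ht d d0 ddt; have {}Hs := Hs d d0 dds.
set t' := Num.min t (T - d) in Ht; set s' := Num.min s (T - d) in Hs.
have rg r : tau <= r -> tau / 2 <= Num.min r (T - d) < T.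
  move=> taur; rewrite le_min gt_min; apply/andP; split.
    by apply/andP; split; lra.
  by apply/orP; right; lra.
have := holder x y t' s' (rg t t1) (rg s s1).
have clamp : `|t' - s'| <= `|t - s|.
  exact: dist_min_le.
have : C * (enorm (x - y) `^ al + `|t' - s'| `^ be) <=
       C * (enorm (x - y) `^ al + `|t - s| `^ be).
  by rewrite ler_wpM2l// lerD2l ge0_ler_powR ?nnegrE.
have := ler_distD (u (x, t')) (u (x, t)) (u (y, s)).
have := ler_distD (u (y, s')) (u (x, t')) (u (y, s)).
rewrite [`|u (y, s') - _|]distrC; lra.
Qed.

Lemma holder_interior (R : realType) N (p A c eta M T ga X hb : R)
    (u : 'rV[R]_N * R -> R) :
  let La := time_ratio p A c in
  let Cx := 2 * eta + A * 2 `^ (p - 1) * (1 + X) + 2 * M / hb `^ ga in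
  1 < p -> 0 < A -> 0 < c -> 0 <= eta -> 0 <= M ->
  (forall x t, 0 < t < T -> `|u (x, t)| <= M) ->
  action_upper p A eta T u -> action_lower p c eta T u ->
  0 < ga < 1 -> 0 <= X -> 0 < hb <= 1 ->
  (2 * M + eta) / c * (La / hb) `^ ga <= X ->
  decay_error p A c eta * La <= X * (1 - decay_rate p A c * La `^ ga) ->
  forall x y t s, hb < t < T -> hb < s < T ->
  `|u (x, t) - u (y, s)| <=
    (Cx + (eta + Cx * (1 + X) + 2 * M / hb `^ ga)) *
    (enorm (x - y) `^ (ga * p / (p - 1 + ga)) + `|t - s| `^ ga).
Proof.
move=> La Cx p1 A0 c0 eta0 M0 uM u_upper u_lower ga01 X0 hb01 XM Xd.
have Cx0 : 0 <= Cx.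
  have [hb0 _] := andP hb01.
  rewrite !addr_ge0 ?divr_ge0 ?mulr_ge0 ?powR_ge0 ?(ltW A0)//; lra.
set Ct := eta + _ + _.
have Ct0 : 0 <= Ct.
  rewrite !addr_ge0 ?divr_ge0 ?mulr_ge0 ?powR_ge0//; lra.
have hbpos : 0 < hb by case/andP: hb01.
have step x t : hb < t -> t < T -> forall h, 0 < h <= hb -> exists y,
    action p h (enorm (x - y)) <= X * h `^ ga /\ u (y, t - h) - eta * h <= u (x, t).
  move=> hbt tT h hh.
  exact: (short_step x p1 A0 c0 eta0 M0 uM u_upper u_lower ga01 X0 hb01 hbt tT XM Xd hh).
have space1 x x' t : hb < t -> t < T ->
    u (x', t) - u (x, t) <= Cx * enorm (x - x') `^ (ga * p / (p - 1 + ga)).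
  move=> hbt tT.
  exact: (holder_space x' p1 A0 eta0 M0 uM u_upper ga01 X0 hb01 hbt tT
    (step x t hbt tT)).
have space x x' t : hb < t -> t < T ->
    `|u (x, t) - u (x', t)| <= Cx * enorm (x - x') `^ (ga * p / (p - 1 + ga)).
  move=> hbt tT; rewrite ler_norml; apply/andP; split.
    by have := space1 x x' t hbt tT; lra.
  by rewrite enormC; exact: space1.
have time x t s : hb < s -> s < t -> t < T ->
    `|u (x, t) - u (x, s)| <= Ct * (t - s) `^ ga.
  move=> hbs st tT.
  have s0 : 0 < s by lra.
  apply: (holder_time p1 A0 eta0 M0 uM u_upper ga01 X0 hb01 s0 st tT Cx0).
    by apply: step => //; exact: lt_trans st.
  move=> y; rewrite enormC; apply: space1 => //; exact: lt_trans tT.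
have ordered x y t s : hb < s -> s <= t -> t < T ->
    `|u (x, t) - u (y, s)| <= (Cx + Ct) *
      (enorm (x - y) `^ (ga * p / (p - 1 + ga)) + (t - s) `^ ga).
  move=> hbs st tT.
  have sT : s < T by exact: le_lt_trans tT.
  set d := _ `^ (_ / _); have d0 : 0 <= d by exact: powR_ge0.
  have ts0 : 0 <= (t - s) `^ ga by exact: powR_ge0.
  have sp : `|u (x, s) - u (y, s)| <= Cx * d by exact: space.
  have tm : `|u (x, t) - u (x, s)| <= Ct * (t - s) `^ ga.
    move: st; rewrite le_eqVlt => /predU1P[<-|st]; last exact: time.
    by rewrite subrr normr0 mulr_ge0// powR_ge0.
  have := ler_distD (u (x, s)) (u (x, t)) (u (y, s)).
  have := mulr_ge0 Cx0 ts0; have := mulr_ge0 Ct0 d0; lra.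
move=> x y t s /andP[hbt tT] /andP[hbs sT].
have [st|ts] := leP s t.
  by rewrite [`|t - s|]ger0_norm ?subr_ge0//; exact: ordered.
rewrite distrC enormC [`|t - s|]ltr0_norm ?subr_lt0// opprB.
by apply: ordered => //; exact: ltW.
Qed.

Theorem theorem4p1 (R : realType) (N : nat) (q p delta eta_m eta_p M : R)
    (N_ge1 : (1 <= N)%N) (q_gt1 : 1 < q) (pq_conj : p^-1 + q^-1 = 1)
    (delta_gt1 : 1 < delta) (eta_m_ge0 : 0 <= eta_m) (eta_p_ge0 : 0 <= eta_p)
    (M_gt0 : 0 < M) :
  exists theta : R, p < theta /\
  exists C : R -> R, (forall tau : R, 0 < tau -> 0 < C tau) /\
  forall (T : R), 0 < T ->
  forall (H : 'rV[R]_N -> R -> 'rV[R]_N -> R),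
    hamiltonian_continuous T H ->
    (forall (x : 'rV[R]_N) (t : R) (z : 'rV[R]_N), 0 < t < T ->
       delta^-1 * enorm z `^ q - eta_m <= H x t z <=
         delta * enorm z `^ q + eta_p) ->
  forall (u : 'rV[R]_N * R -> R),
    {within [set xt : 'rV[R]_N * R | 0 <= xt.2 <= T], continuous u} ->
    viscosity_solution T H u ->
    (forall (x : 'rV[R]_N) (t : R), 0 < t < T -> `|u (x, t)| <= M) ->
  forall (tau : R), 0 < tau <= T ->
  forall (x y : 'rV[R]_N) (t s : R), tau <= t <= T -> tau <= s <= T ->
    `|u (x, t) - u (y, s)| <=
      C tau * (enorm (x - y) `^ ((theta - p) / (theta - 1)) +
               `|t - s| `^ ((theta - p) / theta)).
Proof.
have q0 : 0 < q by lra.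
have [qV0 qV1] : 0 < q^-1 /\ q^-1 < 1 by rewrite invr_gt0 invf_lt1.
have p1 : 1 < p.
  have [] : 0 < p^-1 /\ p^-1 < 1 by split; lra.
  by rewrite invr_gt0 => p0; rewrite invf_lt1.
have p0 : 0 < p by lra.
have d0 : 0 < delta by lra.
pose A := delta `^ (p - 1); have A0 : 0 < A by exact: powR_gt0.
pose c := super_cst p q delta; have c0 : 0 < c by exact: super_cst_gt0.
pose eta := eta_m + eta_p + 1; have eta0 : 0 < eta by rewrite /eta; lra.
pose La := time_ratio p A c; have La1 : 1 < La by exact: time_ratio_gt1.
pose mu := decay_rate p A c.
have [ga [ga01 muLa]] : exists ga, 0 < ga < 1 /\ mu * La `^ ga < 1.
  exact: exists_small_exponent (decay_rate_itv p A0 c0) La1.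
have [ga0 ga1] := andP ga01.
pose D := decay_error p A c eta; have D0 : 0 <= D.
  by apply: decay_error_ge0 => //; exact: ltW.
(* So that [(theta - p) / theta = ga]. *)
pose theta := p / (1 - ga).
(* The largest time step: small enough that [t - h] stays positive for
   [tau / 2 <= t], and at most [1], so that [h <= h ^ ga]. *)
pose hb (tau : R) := Num.min (tau / 4) 1.
(* The sum of the two lower bounds required of [X] by [chain_action_small]. *)
pose X tau := (2 * M + eta) / c * (La / hb tau) `^ ga
              + D * La / (1 - mu * La `^ ga).
pose Cx tau := 2 * eta + A * 2 `^ (p - 1) * (1 + X tau) + 2 * M / hb tau `^ ga.
pose C tau := Cx tau + (eta + Cx tau * (1 + X tau) + 2 * M / hb tau `^ ga).
have X1 tau : 0 <= (2 * M + eta) / c * (La / hb tau) `^ ga.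
  by rewrite mulr_ge0 ?powR_ge0// divr_ge0 ?(ltW c0)// addr_ge0 ?mulr_ge0// ltW.
have X2 : 0 <= D * La / (1 - mu * La `^ ga).
  apply: divr_ge0; last by rewrite subr_ge0 ltW.
  by apply: mulr_ge0 => //; exact: ltW (lt_trans ltr01 La1).
have X0 tau : 0 <= X tau by rewrite addr_ge0.
have Mhb tau : 0 <= 2 * M / hb tau `^ ga.
  by rewrite divr_ge0 ?powR_ge0 ?mulr_ge0// ltW.
have AX tau : 0 <= A * 2 `^ (p - 1) * (1 + X tau).
  by rewrite !mulr_ge0 ?powR_ge0 ?addr_ge0// ltW.
have Cx0 tau : 0 < Cx tau.
  by rewrite /Cx; have := AX tau; have := Mhb tau; lra.
have C0 tau : 0 < C tau.
  rewrite /C; have := mulr_ge0 (ltW (Cx0 tau)) (addr_ge0 ler01 (X0 tau)).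
  by have := Cx0 tau; have := Mhb tau; lra.
exists theta; split.
  by rewrite /theta ltr_pdivlMr; [rewrite gtr_pMr//; lra|lra].
exists C; split=> [tau _|]; first exact: C0.
move=> T T0 H _ Hgrowth u uC [uS usub usup] uM tau /andP[tau0 tauT].
have -> : (theta - p) / (theta - 1) = ga * p / (p - 1 + ga).
  by rewrite /theta; field; apply/andP; split; lra.
have -> : (theta - p) / theta = ga.
  by rewrite /theta; field; apply/andP; split; lra.
have uat := strip_continuous_at uS.
have u_upper : action_upper p A eta T u.
  move=> x y s t s0 st tT.
  have low x' t' z : 0 < t' < T -> delta^-1 * enorm z `^ q - eta_m <= H x' t' z.
    by move=> /(Hgrowth x' t' z)/andP[].
  have := subsolution_action_upper p0 q0 pq_conj d0 eta_m_ge0 low uat uM usub x y s0 st tT.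
  have : 0 <= eta_p * (t - s) by rewrite mulr_ge0//; lra.
  by rewrite /eta -/A; lra.
have u_lower : action_lower p c eta T u.
  move=> x s t s0 st tT.
  have up x' t' z : 0 < t' < T -> H x' t' z <= delta * enorm z `^ q + eta_p.
    by move=> /(Hgrowth x' t' z)/andP[].
  have [y] := supersolution_action_lower p1 q_gt1 pq_conj d0 eta_p_ge0 up uat uM usup x s0 st tT.
  have : 0 <= eta_m * (t - s) by rewrite mulr_ge0//; lra.
  by rewrite -/c => ? ?; exists y; rewrite /eta; lra.
have hb4 : hb tau <= tau / 4 by rewrite /hb ge_min lexx.
have hb01 : 0 < hb tau <= 1.
  by rewrite /hb lt_min ge_min lexx orbT ltr01 divr_gt0.
apply: holder_closure => //.
- by rewrite tau0.
- exact: ltW (C0 _).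
- exact: ltW.
move=> x y t s /andP[t1 t2] /andP[s1 s2].
apply: (holder_interior p1 A0 c0 (ltW eta0) (ltW M_gt0) uM u_upper u_lower ga01
  (X0 tau) hb01).
- by rewrite /X lerDl.
- rewrite -/D -/mu -/La /X mulrDl mulfVK; last by rewrite gt_eqF// subr_gt0.
  by rewrite lerDr mulr_ge0 ?X1// subr_ge0 ltW.
- by rewrite t2 andbT; lra.
- by rewrite s2 andbT; lra.
Qed.
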